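(* Let $f:[0,+\infty)\to(-\infty,0]$ be a smooth function such that (i) $f'(t)<0$ for all $t\ge 0$, and (ii) $f(0)=0$. Then the space $\mathcal{MF}(T^2)$ admits a $\mathrm{MCG}(T^2)$-invariant pseudo-Kähler structure $(\mathbf{g}_f,\boldsymbol{\omega}_f,\mathbf{I})$ such that the complex structure $\mathbf{I}$ comes from the identification of $\mathcal{MF}(T^2)$ with the complement of the zero section in $\mathcal{Q}^4(T^2)$.
   Context: Linear model. Let $\rho_0=dx_0\wedge dy_0$ on $\mathbb{R}^2$, and $\mathcal{J}(\mathbb{R}^2)=\{J\in\mathrm{End}(\mathbb{R}^2): J^2=-\mathrm{Id},\ \rho_0(v,Jv)>0 \text{ for some } v\ne 0\}$, a real $2$-manifold, with $T_J\mathcal{J}(\mathbb{R}^2)=\{\dot J: J\dot J+\dot JJ=0\}$. For $J\in\mathcal{J}(\mathbb{R}^2)$, $g_J(\cdot,\cdot)=\rho_0(\cdot,J\cdot)$ is a scalar product on $\mathbb{R}^2$. Let $\mathcal{M}(\mathbb{R}^2)=\{(J,T): J\in\mathcal{J}(\mathbb{R}^2),\ T \text{ a totally symmetric } (0,4)\text{-tensor on } \mathbb{R}^2,\ T(J\cdot,J\cdot,\cdot,\cdot)=-T\}$, a smooth $4$-manifold and vector bundle over $\mathcal{J}(\mathbb{R}^2)$. To $(J,T)$ associate $U=g_J^{-1}T$, i.e. $U(X,Y)\in\mathrm{End}(\mathbb{R}^2)$ with $g_J(U(X,Y)Z,W)=T(X,Y,Z,W)$; write $(J,U)$ for $(J,T)$.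 Identification. $\mathcal{T}(T^2)\cong\mathcal{J}(\mathbb{R}^2)$ equivariantly for $\mathrm{MCG}(T^2)\cong\mathrm{SL}(2,\mathbb{Z})$; the bundle $\mathcal{Q}^4(T^2)$ of holomorphic quartic differentials over $\mathcal{T}(T^2)$ is identified with $\mathcal{M}(\mathbb{R}^2)$ by $q\leftrightarrow T=\mathrm{Re}(q)$, $q=T-iT(\cdot,\cdot,\cdot,J\cdot)$. $\mathcal{MF}(T^2)$, the space of complete flat maximal space-like embeddings $\mathbb{R}^2\hookrightarrow\mathbb{H}^{2,2}$ equivariant under a faithful representation $\pi_1(T^2)\to\mathrm{SO}_0(2,3)$, up to $\mathrm{SO}_0(2,3)$, is identified with the complement of the zero section in $\mathcal{Q}^4(T^2)\cong\mathcal{M}(\mathbb{R}^2)$. $\mathrm{SL}(2,\mathbb{R})$ acts on $\mathcal{M}(\mathbb{R}^2)$ by $A\cdot(J,T)=(AJA^{-1},(A^{-1})^*T)$, equivalently $A\cdot U=AU(A^{-1}\cdot,A^{-1}\cdot)A^{-1}$; $\mathrm{MCG}(T^2)\cong\mathrm{SL}(2,\mathbb{Z})$ acts by restriction. Tensors. A tangent vector at $(J,U)$ is written $(\dot J,\dot U)$, where $\dot J,\dot T$ are the first variations of $J,T$ along a curve and $\dot U:=g_J^{-1}\dot T$. Put $\dot U_{\mathrm{tr}}(X,Y)=\tfrac12\mathrm{tr}(\dot U(X,Y))\mathrm{Id}$ and $\dot U_0=\dot U-\dot U_{\mathrm{tr}}$. Let $\langle\dot J,\dot J'\rangle=\tfrac12\mathrm{tr}(\dot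 J\dot J')$ and, for tensors $V,V'$ that are symmetric bilinear forms with values in $\mathrm{End}(\mathbb{R}^2)$, $\langle V,V'\rangle=\tfrac14\sum_{i,j=1}^2\mathrm{tr}\big(V(e_i,e_j)V'(e_i,e_j)\big)$ with $\{e_1,e_2=Je_1\}$ a $g_J$-orthonormal basis; $\|U\|^2=\langle U,U\rangle$. Define $$\mathbf{g}_f\big((\dot J,\dot U),(\dot J',\dot U')\big)=\Big(1-f\big(\tfrac{\|U\|^2}{2}\big)\Big)\langle\dot J,\dot J'\rangle+\tfrac12f'\big(\tfrac{\|U\|^2}{2}\big)\Big(\langle\dot U_0,\dot U_0'\rangle-\langle\dot U_{\mathrm{tr}},\dot U_{\mathrm{tr}}'\rangle\Big),$$ $$\mathbf{I}(\dot J,\dot U)=(-J\dot J,\,-\dot UJ-U\dot J),\qquad \boldsymbol{\omega}_f(\cdot,\cdot)=\mathbf{g}_f(\cdot,\mathbf{I}\cdot),$$ where $\dot UJ$, $U\dot J$ are compositions of endomorphisms, $(\dot UJ)(X,Y)=\dot U(X,Y)J$. The map $\mathbf{I}$ is the complex structure coming from $\mathcal{Q}^4(T^2)$: it acts by $\dot J\mapsto -J\dot J$ on the base and corresponds to $\dot q\mapsto -i\dot q$ on the quartic differential. A pseudo-Kähler structure is a triple $(\mathbf g,\boldsymbol\omega,\mathbf I)$ with $\mathbf g$ a pseudo-Riemannian metric, $\mathbf I$ an integrable complex structure with $\mathbf g(\mathbf I\cdot,\mathbf I\cdot)=\mathbf g$, and $\boldsymbol\omega=\mathbf g(\cdot,\mathbf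 I\cdot)$ closed. *)

(* Defs.v *)
From HB Require Import structures.
From mathcomp Require Import all_boot all_order all_algebra.
From mathcomp Require Import all_classical all_reals all_analysis.
From mathcomp Require Import ring lra.

Set Implicit Arguments.
Unset Strict Implicit.
Unset Printing Implicit Defensive.

Import Order.TTheory GRing.Theory Num.Theory.
Import numFieldNormedType.Exports.

Local Open Scope classical_set_scope.
Local Open Scope ring_scope.

(** * Smooth functions on the closed half-line [0, +oo[ *)

Section HalfLine.
Context {R : realType}.
Implicit Types (f : R -> R) (t : R).

Definition hl_quotient f t : R -> R := fun s => (f s - f t) / (s - t).

(* s tends to t with s >= 0 and s <> t: a one-sided limit at t = 0. *)
Definition hl_nbhs t : set_system R := within [set s | 0 <= s] t^'.

Definition hl_derive f : R -> R := fun t => lim (hl_quotient f t @ hl_nbhs t).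

Definition hl_smooth f : Prop :=
  forall (n : nat) t, 0 <= t -> cvg (hl_quotient (iter n hl_derive f) t @ hl_nbhs t).

End HalfLine.

(** * Submanifolds of normed spaces and tensors on them *)

Section Smooth.
Context {R : realType}.

Definition iter_derive (V W : normedModType R) (vs : seq V) (h : V -> W) : V -> W :=
  foldr (fun (v : V) (k : V -> W) (x : V) => 'D_v k x) h vs.

(* C^oo (only used in finite dimension): all iterated directional derivatives
   are Frechet differentiable. *)
Definition smooth_on (V W : normedModType R) (O : set V) (h : V -> W) : Prop :=
  forall (vs : seq V) (x : V), O x -> differentiable (iter_derive vs h) x.

Variable V : normedModType R.

Definition tangent (M : set V) (p : V) : set V :=
  [set v | exists c : R -> V,
     [/\ c 0 = p, (\forall t \near 0, M (c t)) & is_derive (0 : R) (1 : R) c v]].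

(* phi parametrizes the relatively open piece M `&` W of M by the open set O of
   R^(n+1).  The smooth left inverse psi is defined on a neighbourhood in the
   ambient space, so phi is an immersion and a homeomorphism onto its image. *)
Definition local_param n (M : set V) (O : set 'rV[R]_n.+1) (phi : 'rV[R]_n.+1 -> V) : Prop :=
  exists (W : set V) (psi : V -> 'rV[R]_n.+1),
    [/\ open O, open W & phi @` O = M `&` W] /\
    [/\ smooth_on O phi, smooth_on W psi & forall x, O x -> psi (phi x) = x].

(* M is covered by (n+1)-dimensional local parametrizations satisfying Q. *)
Definition locally_param n (M : set V)
    (Q : set 'rV[R]_n.+1 -> ('rV[R]_n.+1 -> V) -> Prop) : Prop :=
  forall p, M p -> exists (O : set 'rV[R]_n.+1) (phi : 'rV[R]_n.+1 -> V),
    [/\ local_param M O phi, (phi @` O) p & Q O phi].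

Definition submanifold n (M : set V) : Prop := @locally_param n M (fun _ _ => True).

(* A covariant 2-tensor b on M is given by b p v w, for v, w in tangent M p; an
   endomorphism field I by I p v.  Values on other vectors are irrelevant. *)

Definition pull_tensor n (phi : 'rV[R]_n.+1 -> V) (b : V -> V -> V -> R)
    (v w : 'rV[R]_n.+1) : 'rV[R]_n.+1 -> R :=
  fun x => b (phi x) ('D_v phi x) ('D_w phi x).

Definition bilinear_tensor (M : set V) (b : V -> V -> V -> R) : Prop :=
  forall p (a : R) u v w, M p -> tangent M p u -> tangent M p v -> tangent M p w ->
    b p (a *: u + v) w = a * b p u w + b p v w /\
    b p w (a *: u + v) = a * b p w u + b p w v.

Definition smooth_tensor n (M : set V) (b : V -> V -> V -> R) : Prop :=
  @locally_param n M (fun O phi => forall v w : 'rV[R]_n.+1, smooth_on O (pull_tensor phi b v w)).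

(* Nondegeneracy and smoothness make the signature locally constant. *)
Definition pseudo_riemannian n (M : set V) (g : V -> V -> V -> R) : Prop :=
  [/\ bilinear_tensor M g,
      smooth_tensor n M g,
      (forall p v w, M p -> tangent M p v -> tangent M p w -> g p v w = g p w v)
    & (forall p v, M p -> tangent M p v ->
         (forall w, tangent M p w -> g p v w = 0) -> v = 0)].

(* The exterior derivative is computed on the constant fields u, v, w, whose
   brackets vanish. *)
Definition closed_two_form n (M : set V) (om : V -> V -> V -> R) : Prop :=
  [/\ bilinear_tensor M om,
      (forall p v, M p -> tangent M p v -> om p v v = 0)
    & @locally_param n M (fun O phi =>
        (forall v w : 'rV[R]_n.+1, smooth_on O (pull_tensor phi om v w)) /\
        forall u v w x : 'rV[R]_n.+1, O x ->
          'D_u (pull_tensor phi om v w) x + 'D_v (pull_tensor phi om w u) x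
          + 'D_w (pull_tensor phi om u v) x = 0)].

(* Multiplication by i on R^(m+m) = C^m, (x, y) <-> x + iy. *)
Definition mul_i m (u : 'rV[R]_(m.+1 + m.+1)) : 'rV[R]_(m.+1 + m.+1) :=
  row_mx (- rsubmx u) (lsubmx u).

Definition almost_complex (M : set V) (I : V -> V -> V) : Prop :=
  forall p (a : R) v w, M p -> tangent M p v -> tangent M p w ->
    [/\ tangent M p (I p v), I p (a *: v + w) = a *: I p v + I p w
      & I p (I p v) = - v].

(* Integrability: M is covered by charts with values in C^(m+1) which are
   holomorphic with respect to I. *)
Definition complex_structure m (M : set V) (I : V -> V -> V) : Prop :=
  almost_complex M I /\
  @locally_param (m + m.+1) M (fun O phi =>
    forall (u x : 'rV[R]_(m.+1 + m.+1)), O x ->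
      'D_(mul_i u) phi x = I (phi x) ('D_u phi x)).

(* The real dimension of M is 2 (m + 1). *)
Definition pseudo_kahler m (M : set V) (g om : V -> V -> V -> R) (I : V -> V -> V) : Prop :=
  [/\ submanifold (m + m.+1) M, pseudo_riemannian (m + m.+1) M g
    & complex_structure m M I] /\
  [/\ (forall p v w, M p -> tangent M p v -> tangent M p w ->
         g p (I p v) (I p w) = g p v w),
      (forall p v w, M p -> tangent M p v -> tangent M p w ->
         om p v w = g p v (I p w))
    & closed_two_form (m + m.+1) M om].

(* The map F preserves M, g, om and I. *)
Definition invariant_under (M : set V) (F : V -> V) (g om : V -> V -> V -> R)
    (I : V -> V -> V) : Prop :=
  (forall p, M p -> M (F p)) /\
  forall p v w, M p -> tangent M p v -> tangent M p w ->
    [/\ g (F p) ('D_v F p) ('D_w F p) = g p v w,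
        om (F p) ('D_v F p) ('D_w F p) = om p v w
      & I (F p) ('D_v F p) = 'D_(I p v) F p].

End Smooth.

(** * The linear model M(R^2) *)

Section LinearModel.
Context {R : realType}.

Notation vect := 'cV[R]_2.
Notation endo := 'M[R]_2.
(* A (0,4)-tensor T on R^2, with T(e_i, e_j, e_k, e_l) the entry at row (i, j)
   and column (k, l). *)
Notation tens := 'M[R]_(2 * 2).

Definition teval (T : tens) (X Y Z W : vect) : R :=
  \sum_(i < 2) \sum_(j < 2) \sum_(k < 2) \sum_(l < 2)
    T (mxvec_index i j) (mxvec_index k l) * X i 0 * Y j 0 * Z k 0 * W l 0.

Definition bvec (i : 'I_2) : vect := delta_mx i 0.

Definition tensor_of (t : vect -> vect -> vect -> vect -> R) : tens :=
  \matrix_(a, b)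
    mxvec (\matrix_(i, j)
      mxvec (\matrix_(k, l) t (bvec i) (bvec j) (bvec k) (bvec l)) 0 b) 0 a.

Definition rho0 (X Y : vect) : R := X 0 0 * Y 1 0 - X 1 0 * Y 0 0.

Definition JR2 : set endo :=
  [set J | J *m J = - 1%:M /\ exists2 v : vect, v != 0 & 0 < rho0 v (J *m v)].

Definition gJ (J : endo) (X Y : vect) : R := rho0 X (J *m Y).

Definition totally_symmetric (T : tens) : Prop :=
  forall X Y Z W : vect,
    [/\ teval T Y X Z W = teval T X Y Z W, teval T X Z Y W = teval T X Y Z W
      & teval T X Y W Z = teval T X Y Z W].

Definition MR2 : set (endo * tens) :=
  [set p | [/\ JR2 p.1, totally_symmetric p.2
             & forall X Y Z W : vect,
                 teval p.2 (p.1 *m X) (p.1 *m Y) Z W = - teval p.2 X Y Z W]].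

(* The complement of the zero section, with which MF(T^2) is identified. *)
Definition MR2star : set (endo * tens) := [set p | MR2 p /\ p.2 != 0].

Notation etens := (vect -> vect -> endo).

(* g_J^-1 T: the Gram matrix of g_J is invertible for J in JR2. *)
Definition gram (J : endo) : endo := \matrix_(i, j) gJ J (bvec i) (bvec j).
Definition sharp (J : endo) (T : tens) : etens := fun X Y =>
  (\matrix_(k, l) teval T X Y (bvec k) (bvec l) *m invmx (gram J))^T.
Definition flat (J : endo) (V : etens) : tens :=
  tensor_of (fun X Y Z W => gJ J (V X Y *m Z) W).

Definition tr_part (V : etens) : etens := fun X Y => (2^-1 * \tr (V X Y))%:M.
Definition tf_part (V : etens) : etens := fun X Y => V X Y - tr_part V X Y.

(* The g_J-orthonormal basis (e1, J e1) with e1 proportional to (1, 0); any other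
   basis of this form gives the same innerV. *)
Definition onb1 (J : endo) : vect := (Num.sqrt (gJ J (bvec 0) (bvec 0)))^-1 *: bvec 0.
Definition onb (J : endo) (i : 'I_2) : vect :=
  if i == 0 then onb1 J else J *m onb1 J.

Definition innerJ (A B : endo) : R := 2^-1 * \tr (A *m B).
Definition innerV (J : endo) (V V' : etens) : R :=
  4^-1 * \sum_(i < 2) \sum_(j < 2)
    \tr (V (onb J i) (onb J j) *m V' (onb J i) (onb J j)).

Definition Uof (p : endo * tens) : etens := sharp p.1 p.2.
Definition normU2 (p : endo * tens) : R := innerV p.1 (Uof p) (Uof p).

(* Tangent vectors at p = (J, T) are pairs v = (J', T') of first variations;
   their second component enters the formulas as U' = g_J^-1 T'. *)
Definition dU (p v : endo * tens) : etens := sharp p.1 v.2.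

Definition g_f (f : R -> R) (p v w : endo * tens) : R :=
  (1 - f (normU2 p / 2)) * innerJ v.1 w.1
  + 2^-1 * hl_derive f (normU2 p / 2) *
      (innerV p.1 (tf_part (dU p v)) (tf_part (dU p w))
       - innerV p.1 (tr_part (dU p v)) (tr_part (dU p w))).

Definition Istr (p v : endo * tens) : endo * tens :=
  (- (p.1 *m v.1),
   flat p.1 (fun X Y => - (dU p v X Y *m p.1) - Uof p X Y *m v.1)).

Definition omega_f (f : R -> R) (p v w : endo * tens) : R := g_f f p v (Istr p w).

Definition act (A : endo) (p : endo * tens) : endo * tens :=
  (A *m p.1 *m invmx A,
   tensor_of (fun X Y Z W =>
     teval p.2 (invmx A *m X) (invmx A *m Y) (invmx A *m Z) (invmx A *m W))).

Definition SL2Z_mx (A : 'M[int]_2) : endo := map_mx intr A.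

(** sharp, onb and tensor_of satisfy their defining properties. *)

Let sum2 (F : 'I_2 -> R) : \sum_(i < 2) F i = F 0 + F 1.
Proof.
rewrite !big_ord_recl big_ord0 addr0; congr (_ + F _); exact: val_inj.
Qed.

Lemma gJE (J : endo) (X Y : vect) : gJ J X Y =
  X 0 0 * (J 1 0 * Y 0 0 + J 1 1 * Y 1 0) - X 1 0 * (J 0 0 * Y 0 0 + J 0 1 * Y 1 0).
Proof. by rewrite /gJ /rho0 !mxE !sum2. Qed.

Lemma JR2E (J : endo) : JR2 J ->
  [/\ J 1 1 = - J 0 0, J 0 0 * J 0 0 + J 0 1 * J 1 0 = -1 & 0 < J 1 0].
Proof.
move=> [/matrixP J2 [v v0]]; rewrite -/(gJ J v v) gJE.
have e1 := J2 1 0; have e2 := J2 0 1; have e3 := J2 0 0.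
move: e1 e2 e3; rewrite !mxE !sum2 /= ?mulr0n ?mulr1n ?oppr0.
set a := J 0 0; set b := J 0 1; set c := J 1 0; set d := J 1 1 => e1 e2 e3 h.
have h1 : c * (a + d) = 0 by rewrite -e1; ring.
have bc0 : c != 0.
  apply/eqP => c0; move: e3; rewrite c0 mulr0 addr0 => e.
  by have := sqr_ge0 a; rewrite expr2 e oppr_ge0 ler10.
have dE : d = - a by move/eqP: h1; rewrite mulf_eq0 (negbTE bc0) /= addrC addr_eq0 => /eqP.
split=> //.
move: h; rewrite dE; set x := v 0 0; set y := v 1 0 => h.
rewrite lt_def bc0 /= leNgt; apply/negP => cl.
have : 0 < (x * (c * x + - a * y) - y * (a * x + b * y)) * (-c) by rewrite mulr_gt0 // oppr_gt0.
have -> : (x * (c * x + - a * y) - y * (a * x + b * y)) * (-c) =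
  - (c * x - a * y) ^+ 2 + (a * a + b * c) * y ^+ 2 by ring.
rewrite e3 => h'. have := sqr_ge0 (c * x - a * y); have := sqr_ge0 y. lra.
Qed.

Lemma tensor_ofE t (i j k l : 'I_2) :
  tensor_of t (mxvec_index i j) (mxvec_index k l)
  = t (bvec i) (bvec j) (bvec k) (bvec l) :> R.
Proof. by rewrite mxE mxvecE mxE mxvecE mxE. Qed.

Lemma tevalE (T : 'M[R]_(2 * 2)) (X Y Z W : vect) : teval T X Y Z W =
  \sum_(k < 2) \sum_(l < 2) teval T X Y (bvec k) (bvec l) * Z k 0 * W l 0.
Proof. by rewrite /teval !sum2 /bvec !mxE /=; ring. Qed.

Lemma gramE (J : endo) (X Y : vect) :
  gJ J X Y = (X^T *m gram J *m Y) 0 0.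
Proof. rewrite gJE !mxE !sum2 !mxE !sum2 !mxE !gJE !mxE /=; ring. Qed.

Lemma gram_unit (J : endo) : JR2 J -> gram J \in unitmx.
Proof.
move=> /JR2E[d e c0]; rewrite unitmxE unitfE (expand_det_row _ 0) !sum2 /cofactor !det_mx11 !mxE !gJE !mxE /= d.
apply/eqP => h. have : 1 = 0 :> R by nra.
by move/eqP; rewrite oner_eq0.
Qed.

Lemma sharpP (J : endo) T (X Y Z W : vect) : JR2 J ->
  gJ J (sharp J T X Y *m Z) W = teval T X Y Z W.
Proof.
move=> /gram_unit uJ.
rewrite gramE /sharp trmx_mul trmxK !mulmxA mulmxKV // tevalE.
by rewrite !mxE !sum2 !mxE !sum2 !mxE; ring.
Qed.

Lemma onb_orthonormal (J : endo) i j : JR2 J -> gJ J (onb J i) (onb J j) = (i == j)%:R.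
Proof.
move=> /JR2E[d e c0].
have s2 := @sqr_sqrtr R (J 1 0) (ltW c0).
have sn : Num.sqrt (J 1 0) != 0 by rewrite gt_eqF // sqrtr_gt0.
have h : (Num.sqrt (J 1 0))^-1 ^+ 2 * J 1 0 = 1 by rewrite -{2}s2; field.
have E : gJ J (bvec 0) (bvec 0) = J 1 0 by rewrite gJE !mxE /=; ring.
rewrite /onb /onb1 E; set r := _^-1 in h *.
case: i => [[|[|//]] p]; case: j => [[|[|//]] q] /=; rewrite gJE ?mxE ?sum2 ?mxE /= d; nra.
Qed.

(** Quartic differentials: on the torus with complex structure J the holomorphic
    quartic differentials are the constant ones, i.e. the complex-valued symmetric
    4-tensors q = a + i b on R^2 that are complex linear with respect to J; q is
    encoded by the pair (a, b). *)

Definition Q4 : set (endo * (tens * tens)) :=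
  [set Q | [/\ JR2 Q.1, totally_symmetric Q.2.1, totally_symmetric Q.2.2
             & forall X Y Z W : vect,
                 teval Q.2.1 (Q.1 *m X) Y Z W = - teval Q.2.2 X Y Z W /\
                 teval Q.2.2 (Q.1 *m X) Y Z W = teval Q.2.1 X Y Z W]].

Definition Q4star : set (endo * (tens * tens)) := [set Q | Q4 Q /\ Q.2 != 0].

(* (J, T) |-> (J, T - i T(., ., ., J .)), whose inverse is (J, q) |-> (J, Re q). *)
Definition to_Q4 (p : endo * tens) : endo * (tens * tens) :=
  (p.1, (p.2, - tensor_of (fun X Y Z W => teval p.2 X Y Z (p.1 *m W)))).

(* J' |-> - J J' on the base and q' |-> - i q' on the differential. *)
Definition I_Q4 (Q v : endo * (tens * tens)) : endo * (tens * tens) :=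
  (- (Q.1 *m v.1), (v.2.2, - v.2.1)).

(* I is the complex structure of Q4star transported by to_Q4. *)
Definition comes_from_Q4 (I : endo * tens -> endo * tens -> endo * tens) : Prop :=
  set_bij MR2star Q4star to_Q4 /\
  forall p v, MR2star p -> tangent MR2star p v ->
    'D_(I p v) to_Q4 p = I_Q4 (to_Q4 p) ('D_v to_Q4 p).

End LinearModel.

(* Main.v *)
Require Import Defs.
From HB Require Import structures.
From mathcomp Require Import all_boot all_order all_algebra.
From mathcomp Require Import all_classical all_reals all_analysis.
From mathcomp Require Import ring lra.

Import Order.TTheory GRing.Theory Num.Theory.
Import numFieldNormedType.Exports.

Local Open Scope classical_set_scope.
Local Open Scope ring_scope.

(** M(R^2) has one global holomorphic chart, in which everything becomes explicit.

    For J in J(R^2) exactly one tau = x + i y with y > 0 makes the form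
    alpha = dx_0 + tau dy_0 complex linear, alpha (J v) = i alpha (v), and the
    complex linear quartic forms are the w alpha^4 with w complex.  Hence (J, T)
    corresponds to (tau, w) by T = Re (w alpha^4), and the complement of the zero
    section is the open set y > 0, w <> 0 of C^2 (chart_image).  The coordinates are
    rational in the entries of J and T and conversely (chart_local_param), so the
    tangent spaces are the images of the derivative of the chart
    (tangent_local_param).  The structure I is multiplication by -i on (tau', w')
    (Istr_chart), so i conj tau and i conj w are holomorphic coordinates.

    In the g_J-orthonormal frame (o, J o) with alpha (o) = sqrt y, the variation T'
    of T splits into a part Re (A alpha^4) with A = w' - 2 i w tau' / y and a part of
    type alpha^3 conj alpha.  The latter has a trace-free and a trace component of
    equal norm, which cancel in g_f (innerV_dchart).  Therefore (g_f_chart)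
      g_f = (1 - f(t)) |tau'|^2 / y^2 + f'(t) y^4 |w' - 2 i w tau' / y|^2,
    with t = |U|^2 / 2 = y^4 |w|^2.  This is Hermitian for I, and nondegenerate since
    1 - f(t) > 0 > f'(t) (g_chart_nondegenerate).

    The form w' - 2 i w tau' / y is the Chern connection of the Hermitian metric
    y^4 |w|^2 on the line bundle of quartic forms, and its curvature is a multiple
    of the hyperbolic area form of the base.  So in d omega_f the terms with f''
    vanish, because dt is 2 y^4 times the real part of conj w (w' - 2 i w tau' / y),
    and the derivative of 1 - f(t) compensates the curvature (omega_closed).

    The metric is invariant because sums over a g_J-orthonormal basis do not depend
    on the basis (contraction2_orthonormal), and A in SL(2, R) maps orthonormal bases
    for J to orthonormal bases for A J A^-1.  Finally T is the real part of a
    unique J-linear form, which identifies I with the complex structure of the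
    bundle of quartic differentials (Istr_comes_from_Q4). *)

(** * Derivatives and tangent vectors *)

Section Calculus.
Context {R : realType}.

Lemma near_eq_differentiable (V W : normedModType R) (f g : V -> W) (x : V) :
  (\near x, f x = g x) -> differentiable f x -> differentiable g x.
Proof.
move=> fg df.
suff E : g \o shift x = cst (g x) + 'd f x +o_ (0 : V) id.
  apply/diff_locallyP; have dc := diff_continuous df.
  by rewrite (diff_unique dc E).
have := diff_locally df.
move=> /eqaddoP h; apply/eqaddoP => e e0.
have fg0 : \forall z \near (0 : V), f (z + x) = g (z + x).
  by move: fg; rewrite (near_shift 0); apply: filterS => z; rewrite /= subr0.
apply: filterS2 fg0 (h e e0) => z E.
by rewrite !fctE /= E (nbhs_singleton fg).
Qed.

(** At t > 0 the half-line is a neighbourhood of t, so the one-sided limits are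
    ordinary ones. *)
Lemma hl_smooth_is_derive (F : R -> R) (n : nat) (t : R) :
  hl_smooth F -> 0 < t ->
  is_derive t (1 : R) (iter n hl_derive F) (iter n.+1 hl_derive F t).
Proof.
move=> hF t0; set g := iter n hl_derive F.
have hlE : hl_nbhs t = t^'.
  apply/seteqP; split; last first.
    by move=> A h; rewrite /hl_nbhs; apply: filterS h => s.
  move=> A; rewrite /hl_nbhs => h.
  have hA : \forall s \near t^', 0 <= s -> A s := h.
  have : \forall s \near t^', 0 <= s.
    by apply: nbhs_dnbhs; apply: filterS (lt_nbhsr t0) => s; apply: ltW.
  by apply: filterS2 hA => s + s0; apply.
have := hF n t (ltW t0); rewrite -/g /= /hl_derive hlE => gl.
suff gd : (fun h : R => h^-1 *: ((g \o shift t) (h *: (1 : R)) - g t)) @ 0^' -->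
    (lim (hl_quotient g t @ t^')).
  apply: DeriveDef; last exact: cvg_lim gd.
  by apply/cvg_ex; exists (lim (hl_quotient g t @ t^')).
have tE : (fun h : R => t + h) @ 0^' --> t^'.
  move=> A [e /= e0 eA]; exists e => //= h; rewrite /ball_ /= sub0r normrN => he hn0.
  by apply: eA; rewrite /= ?opprD ?addrA ?subrr ?sub0r ?normrN // -subr_eq0 addrC addKr.
have := cvg_comp _ _ tE gl; apply: cvg_trans; apply: near_eq_cvg.
near=> h; rewrite /= /hl_quotient /= [h *: 1]mulr1 (addrC h t).
by rewrite [t + h - t]addrC addKr mulrC.
Unshelve. all: by end_near. Qed.

Lemma linear_is_diff (V W : normedModType R) (h : V -> W) (x : V) :
  linear h -> continuous h -> is_diff x h h.
Proof.
move=> l ct; pose lM := GRing.isLinear.Build _ _ _ _ _ l.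
pose lL : {linear V -> W} := HB.pack h lM.
apply: DiffDef; first exact: (linear_differentiable (f := lL)).
exact: (diff_lin (f := lL)).
Qed.

(** The difference quotient is exactly l + t q. *)
Lemma derive_quadratic (V W : normedModType R) (h : V -> W) (p v : V) (l q : W) :
  (forall t : R, h (t *: v + p) = h p + (t *: l + t ^+ 2 *: q)) -> 'D_v h p = l.
Proof.
move=> E; apply: cvg_lim => //.
have : l + t *: q @[t --> (0 : R)^'] --> l + (0 : R) *: q.
  apply: cvg_within_filter.
  apply: cvgD; first exact: cvg_cst.
  by apply: cvgZr_tmp; exact: cvg_id.
rewrite scale0r addr0; apply: cvg_trans; apply: near_eq_cvg.
near=> t; have t0 : t != 0 by near: t; exact: nbhs_dnbhs_neq.
rewrite /= E [h p + _]addrC addrK scalerDr !scalerA expr2 mulrA mulVf // scale1r mul1r //.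
Unshelve. all: by end_near. Qed.

Lemma derive_linear (V W : normedModType R) (h : V -> W) (p v : V) :
  linear h -> 'D_v h p = h v.
Proof.
move=> l; apply: (derive_quadratic _ _ h p v (h v) 0) => t.
by rewrite l scaler0 addr0 addrC.
Qed.

End Calculus.

Section Tangent.
Context {R : realType}.

(** A curve c in M through phi x equals phi (psi c) near 0, so its velocity is the
    image of that of psi c; conversely phi maps line segments to curves in M. *)
Lemma tangent_local_param (V : normedModType R) n (M : set V)
    (O : set 'rV[R]_n.+1) (phi : 'rV[R]_n.+1 -> V) :
  local_param M O phi ->
  forall x, O x -> tangent M (phi x) = range (fun u => 'D_u phi x).
Proof.
move=> [W [psi [[oO oW eW] [sphi spsi psiK]]]] x Ox.
have dphi : differentiable phi x by exact: (sphi [::] x Ox).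
have [Mx Wx] : (M `&` W) (phi x) by rewrite -eW; exists x.
apply/seteqP; split=> [v [c [c0 cM cv]]|_ [u _ <-]].
  have [cd cD] := cv.
  have dc : differentiable c 0 by apply/derivable1_diffP.
  have dpsi : differentiable psi (c 0) by rewrite c0; exact: (spsi [::] _ Wx).
  have E : \forall t \near (0 : R), phi (psi (c t)) = c t.
    have cW : \forall t \near (0 : R), W (c t).
      have := differentiable_continuous dc; apply.
      by rewrite c0; apply: open_nbhs_nbhs; split.
    apply: filterS2 cM cW => t cM cW.
    have : (M `&` W) (c t) by [].
    by rewrite -eW => -[y Oy <-]; rewrite psiK.
  have dphi' : differentiable phi ((psi \o c) 0) by rewrite /= c0 psiK.
  exists ('d psi (c 0) ('d c 0 1)) => //.
  rewrite -cD -(near_eq_derive _ E).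
  have dpc : differentiable (psi \o c) 0 by exact: differentiable_comp.
  rewrite deriveE // (deriveE (f := phi \o (psi \o c))); last first.
    exact: differentiable_comp.
  have -> : 'd (phi \o (psi \o c)) 0 = 'd phi x \o ('d psi (c 0) \o 'd c 0) :> (R -> V).
    by rewrite (diff_comp dpc dphi') (diff_comp dc dpsi) /= c0 (psiK _ Ox).
  by [].
have dl : is_diff (0 : R) (fun t : R => t *: u + x) (fun t => t *: u).
  have -> : (fun t : R => t *: u) = (( *:%R ^~ u) + (cst 0)) :> (R -> _).
    by apply/funext => t; rewrite !fctE addr0.
  exact: is_diffD.
exists (fun t => phi (t *: u + x)); split; first by rewrite scale0r add0r.
  have : \forall y \near (0 : R), O (y *: u + x).
    have := differentiable_continuous (@ex_diff _ _ _ _ _ _ _ dl); apply.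
    by rewrite scale0r add0r; apply: open_nbhs_nbhs; split.
  apply: filterS => t Ot; have : (M `&` W) (phi (t *: u + x)) by rewrite -eW; eexists; eauto.
  by case.
have dphi0 : differentiable phi ((fun t : R => t *: u + x) 0) by rewrite scale0r add0r.
apply: DeriveDef.
  apply: diff_derivable; apply: differentiable_comp => //.
rewrite deriveE; last by apply: differentiable_comp.
rewrite [LHS](_ : _ = 'd (phi \o (fun t : R => t *: u + x)) 0 1) //.
by rewrite diff_comp //= diff_val scale1r scale0r add0r deriveE.
Qed.

End Tangent.

(** * A class of functions closed under differentiation *)

Section Terms.
Context {R : realType} {V : normedModType R} {I : Type}.
Variables (X : I -> V -> R) (F : R -> R).
Hypothesis X_diff : forall i x, is_diff x (X i : V -> R) (X i).

(** Expressions in the linear coordinates X i, where TFun n stands for the n-th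
    derivative of F: the symbolic derivative of an expression is an expression.
    They give smoothness and explicit derivatives at the same time. *)
Inductive fterm : Type :=
  | TCst of R | TVar of I | TAdd of fterm & fterm | TMul of fterm & fterm
  | TInv of fterm | TFun of nat & fterm.

Fixpoint fval (e : fterm) (x : V) : R :=
  match e with
  | TCst c => c
  | TVar i => X i x
  | TAdd e1 e2 => fval e1 x + fval e2 x
  | TMul e1 e2 => fval e1 x * fval e2 x
  | TInv e1 => (fval e1 x)^-1
  | TFun n e1 => iter n hl_derive F (fval e1 x)
  end.

Fixpoint dterm (u : V) (e : fterm) : fterm :=
  match e with
  | TCst c => TCst 0
  | TVar i => TCst (X i u)
  | TAdd e1 e2 => TAdd (dterm u e1) (dterm u e2)
  | TMul e1 e2 => TAdd (TMul (dterm u e1) e2) (TMul e1 (dterm u e2))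
  | TInv e1 => TMul (TCst (-1)) (TMul (dterm u e1) (TMul (TInv e1) (TInv e1)))
  | TFun n e1 => TMul (dterm u e1) (TFun n.+1 e1)
  end.

(** Inverses are taken at nonzero values only, and the derivatives of F at positive
    ones, where they are two-sided. *)
Fixpoint admissible (e : fterm) (x : V) : Prop :=
  match e with
  | TCst _ | TVar _ => True
  | TAdd e1 e2 | TMul e1 e2 => admissible e1 x /\ admissible e2 x
  | TInv e1 => admissible e1 x /\ fval e1 x != 0
  | TFun _ e1 => [/\ hl_smooth F, admissible e1 x & 0 < fval e1 x]
  end.

Lemma admissible_dterm u e x : admissible e x -> admissible (dterm u e) x.
Proof.
elim: e => //= [e1 IH1 e2 IH2|e1 IH1 e2 IH2|e IH|n e IH] [a1 a2]; try move=> a3;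
  do !split; auto.
Qed.

Lemma fval_is_diff e x : admissible e x ->
  is_diff x (fval e : V -> R) (fun u => fval (dterm u e) x).
Proof.
elim: e => [c|i|e1 IH1 e2 IH2|e1 IH1 e2 IH2|e IH|n e IH] /=.
- by move=> _; exact: is_diff_cst.
- by move=> _; exact: X_diff.
- move=> [/IH1 d1 /IH2 d2]; exact: is_diffD.
- move=> [/IH1 d1 /IH2 d2].
  apply: (@is_diff_eq _ _ _ _ _ _ _ (is_diffM d1 d2)).
  apply/funext => u; rewrite addrC; congr (_ + _); exact: mulrC.
- move=> [/IH d1 n0]; have dd := @ex_diff _ _ _ _ _ _ _ d1.
  apply: DiffDef; first exact: differentiableV.
  rewrite diffV // diff_val; apply/funext => u /=.
  by rewrite expr2 invfM [LHS]mulNr mulN1r mulrC.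
- move=> [F_smooth /IH d1 p0].
  have h := hl_smooth_is_derive F n _ F_smooth p0.
  have dF : differentiable (iter n hl_derive F) (fval e x).
    by apply/derivable1_diffP; case: h.
  have dd := @ex_diff _ _ _ _ _ _ _ d1.
  apply: DiffDef; first exact: (differentiable_comp dd dF).
  rewrite [LHS](diff_comp dd dF) diff_val; apply/funext => u /=.
  by rewrite diff1E // derive1E derive_val.
Qed.

Lemma derive_fval u e x : admissible e x ->
  'D_u (fval e : V -> R) x = fval (dterm u e) x.
Proof.
move=> /fval_is_diff d.
by rewrite deriveE ?diff_val //; exact: @ex_diff _ _ _ _ _ _ _ d.
Qed.

Context {W : normedModType R} {J : finType}.
Implicit Types (e : J -> fterm) (b : J -> W).

Definition term_comb b e (x : V) : W := \sum_j fval (e j) x *: b j.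

Lemma term_comb_is_diff b e x : (forall j, admissible (e j) x) ->
  is_diff x (term_comb b e) (fun u => term_comb b (fun j => dterm u (e j)) x).
Proof.
move=> ae; rewrite /term_comb.
suff : is_diff x (\sum_j (fun x => fval (e j) x *: b j))
    (\sum_j (fun u => fval (dterm u (e j)) x *: b j)).
  by rewrite !fct_sumE.
elim/big_rec2: _ => [|j f g _ IH]; first exact: is_diff_cst.
have [dd dv] := fval_is_diff _ _ (ae j).
apply: is_diffD; apply: DiffDef; first exact: differentiableZl.
by rewrite diffZl // dv.
Qed.

(** By induction on the directions, each iterated derivative agrees on O with a
    combination of expressions; O being open, it is then differentiable on O. *)
Lemma smooth_on_term_comb (O : set V) (h : V -> W) b e :
  open O -> (forall x j, O x -> admissible (e j) x) ->
  (forall x, O x -> h x = term_comb b e x) -> smooth_on O h.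
Proof.
move=> oO ae hE vs x Ox.
have [e' [ae' E]] : exists e', (forall x j, O x -> admissible (e' j) x) /\
  forall x, O x -> iter_derive vs h x = term_comb b e' x.
  elim: vs => [|v vs [e' [ae' E]]] /=; first by exists e.
  exists (fun j => dterm v (e' j)); split.
    by move=> y j Oy; apply: admissible_dterm; exact: ae'.
  move=> y Oy.
  have nE : \near y, iter_derive vs h y = term_comb b e' y.
    by apply: filterS (open_nbhs_nbhs (conj oO Oy)); exact: E.
  rewrite (near_eq_derive _ nE).
  have d := term_comb_is_diff b e' y (fun j => ae' y j Oy).
  by rewrite deriveE ?diff_val //; exact: @ex_diff _ _ _ _ _ _ _ d.
have nE : \near x, term_comb b e' x = iter_derive vs h x.
  by apply: filterS (open_nbhs_nbhs (conj oO Ox)) => y /E.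
apply: near_eq_differentiable nE _.
exact: (@ex_diff _ _ _ _ _ _ _ (term_comb_is_diff b e' x (fun j => ae' x j Ox))).
Qed.

End Terms.

(** * Tensors on the plane and orthonormal bases *)

Section LinearAlgebra.
Context {R : realType}.
Notation vect := 'cV[R]_2.
Notation endo := 'M[R]_2.
Notation tens := 'M[R]_(2 * 2).
Implicit Types (J A M : endo) (T : tens) (X Y Z W : vect) (o : 'I_2 -> vect).

Lemma sum2 (A : nmodType) (F : 'I_2 -> A) : \sum_(i < 2) F i = F 0 + F 1.
Proof.
by rewrite !big_ord_recl big_ord0 addr0; congr (_ + F _); exact: val_inj.
Qed.

Lemma teval_bvec T (i j k l : 'I_2) :
  teval T (bvec i) (bvec j) (bvec k) (bvec l) = T (mxvec_index i j) (mxvec_index k l).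
Proof.
rewrite /teval (bigD1 i) //= [X in _ + X]big1 ?addr0; last first.
  move=> i' /negbTE ni; rewrite !big1 // => j' _; rewrite big1 // => k' _.
  by rewrite big1 // => l' _; rewrite !mxE ni /=; ring.
rewrite (bigD1 j) //= [X in _ + X]big1 ?addr0; last first.
  move=> j' /negbTE nj; rewrite big1 // => k' _.
  by rewrite big1 // => l' _; rewrite !mxE nj /=; ring.
rewrite (bigD1 k) //= [X in _ + X]big1 ?addr0; last first.
  by move=> k' /negbTE nk; rewrite big1 // => l' _; rewrite !mxE nk /=; ring.
rewrite (bigD1 l) //= [X in _ + X]big1 ?addr0; last first.
  by move=> l' /negbTE nl; rewrite !mxE nl /=; ring.
by rewrite !mxE !eqxx !mulr1.
Qed.

Lemma tens_ext T T' :
  (forall i j k l : 'I_2, teval T (bvec i) (bvec j) (bvec k) (bvec l) =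
                         teval T' (bvec i) (bvec j) (bvec k) (bvec l)) -> T = T'.
Proof.
move=> h; apply/matrixP => a b; case/mxvec_indexP: a => i j.
by case/mxvec_indexP: b => k l; have := h i j k l; rewrite !teval_bvec.
Qed.

Lemma ord2P (i : 'I_2) : i = 0 \/ i = 1.
Proof. by case: i => [[|[|//]] ?]; [left|right]; exact: val_inj. Qed.

Definition multilinear4 (t : vect -> vect -> vect -> vect -> R) : Prop :=
  [/\ forall c X X' Y Z W, t (c *: X + X') Y Z W = c * t X Y Z W + t X' Y Z W,
      forall c X Y Y' Z W, t X (c *: Y + Y') Z W = c * t X Y Z W + t X Y' Z W,
      forall c X Y Z Z' W, t X Y (c *: Z + Z') W = c * t X Y Z W + t X Y Z' W
    & forall c X Y Z W W', t X Y Z (c *: W + W') = c * t X Y Z W + t X Y Z W'].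

Lemma vectE X : X = X 0 0 *: bvec 0 + (X 1 0 *: bvec 1 + 0).
Proof.
apply/matrixP => i j; rewrite ord1 !mxE.
by case: i => [[|[|//]] p] /=; rewrite ?mulr0 ?mulr1 ?addr0 ?add0r;
  congr (X _ 0); exact: val_inj.
Qed.

Lemma teval_tensor_of t : multilinear4 t ->
  forall X Y Z W, teval (tensor_of t) X Y Z W = t X Y Z W.
Proof.
move=> [h1 h2 h3 h4] X Y Z W.
have z1 Y' Z' W' : t 0 Y' Z' W' = 0.
  by have := h1 (-1) 0 0 Y' Z' W'; rewrite scaler0 addr0 mulN1r addNr.
have z2 Y' Z' W' : t Y' 0 Z' W' = 0.
  by have := h2 (-1) Y' 0 0 Z' W'; rewrite scaler0 addr0 mulN1r addNr.
have z3 Y' Z' W' : t Y' Z' 0 W' = 0.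
  by have := h3 (-1) Y' Z' 0 0 W'; rewrite scaler0 addr0 mulN1r addNr.
have z4 Y' Z' W' : t Y' Z' W' 0 = 0.
  by have := h4 (-1) Y' Z' W' 0 0; rewrite scaler0 addr0 mulN1r addNr.
rewrite /teval !sum2 !tensor_ofE [in RHS](vectE X) !h1 z1 [in RHS](vectE Y) !h2 !z2.
by rewrite [in RHS](vectE Z) !h3 !z3 [in RHS](vectE W) !h4 !z4; ring.
Qed.

Lemma teval_multilinear T : multilinear4 (teval T).
Proof. by split=> *; rewrite /teval !sum2 !mxE; ring. Qed.

Lemma tevalDl T T' (c : R) X Y Z W :
  teval (c *: T + T') X Y Z W = c * teval T X Y Z W + teval T' X Y Z W.
Proof. by rewrite /teval !sum2 !mxE; ring. Qed.

Lemma tevalNl T X Y Z W : teval T (- X) Y Z W = - teval T X Y Z W.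
Proof.
have [h _ _ _] := teval_multilinear T.
have := h (-1) X 0 Y Z W; rewrite scaleN1r addr0 => ->.
by have := h (-1) 0 0 Y Z W; rewrite scaler0 addr0 => ->; ring.
Qed.

Lemma tevalNr T X Y Z W : teval T X Y Z (- W) = - teval T X Y Z W.
Proof.
have [_ _ _ h] := teval_multilinear T.
have := h (-1) X Y Z W 0; rewrite scaleN1r addr0 => ->.
by have := h (-1) X Y Z 0 0; rewrite scaler0 addr0 => ->; ring.
Qed.

Lemma teval_opp T X Y Z W : teval (- T) X Y Z W = - teval T X Y Z W.
Proof. by rewrite /teval !sum2 !mxE; ring. Qed.

Lemma teval0 X Y Z W : teval (0 : tens) X Y Z W = 0.
Proof. by rewrite /teval !sum2 !mxE; ring. Qed.

Definition orthonormal_for J o : Prop := forall i j, gJ J (o i) (o j) = (i == j)%:R.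

Lemma onb_orthonormal_for J : JR2 J -> orthonormal_for J (onb J).
Proof. by move=> JJ i j; exact: onb_orthonormal. Qed.

Definition colmx o : endo := \matrix_(i, k) o k i 0.

Lemma colmx_gram J o : orthonormal_for J o -> colmx o *m (colmx o)^T *m gram J = 1%:M.
Proof.
move=> on; rewrite -mulmxA; apply: mulmx1C; apply/matrixP => i j.
have := on i j; rewrite gramE => e; rewrite [RHS]mxE -e.
by rewrite !mxE; apply: eq_bigr => k _; rewrite !mxE; congr (_ * _);
   apply: eq_bigr => l _; rewrite !mxE.
Qed.

(** If the columns of F form an orthonormal basis then F F^T is the inverse Gram
    matrix, and both sides are the contraction of b with that matrix. *)
Lemma contraction_orthonormal J o o' (b : vect -> vect -> R) :
  orthonormal_for J o -> orthonormal_for J o' ->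
  (forall c X X' Y, b (c *: X + X') Y = c * b X Y + b X' Y) ->
  (forall c X Y Y', b X (c *: Y + Y') = c * b X Y + b X Y') ->
  \sum_i b (o i) (o i) = \sum_i b (o' i) (o' i).
Proof.
move=> on on' b1 b2.
have z1 Y : b 0 Y = 0 by have := b1 (-1) 0 0 Y; rewrite scaler0 addr0 mulN1r addNr.
have z2 Y : b Y 0 = 0 by have := b2 (-1) Y 0 0; rewrite scaler0 addr0 mulN1r addNr.
have E o0 : \sum_i b (o0 i) (o0 i) =
    \sum_i \sum_j (colmx o0 *m (colmx o0)^T) i j * b (bvec i) (bvec j).
  rewrite !sum2 !mxE !sum2 !mxE.
  have bE X Y : b X Y = X 0 0 * (Y 0 0 * b (bvec 0) (bvec 0) + Y 1 0 * b (bvec 0) (bvec 1))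
     + X 1 0 * (Y 0 0 * b (bvec 1) (bvec 0) + Y 1 0 * b (bvec 1) (bvec 1)).
    by rewrite [in LHS](vectE X) !b1 z1 [in LHS](vectE Y) !b2 !z2 !addr0.
  by rewrite !(bE (o0 _) (o0 _)); ring.
rewrite !E; suff -> : colmx o *m (colmx o)^T = colmx o' *m (colmx o')^T by [].
have e1 := colmx_gram J o on; have e2 := colmx_gram J o' on'.
have e3 := mulmx1C e2.
by rewrite -[LHS]mulmx1 -e3 mulmxA e1 mul1mx.
Qed.

Lemma contraction2_orthonormal J o o' (q : vect -> vect -> vect -> vect -> R) :
  orthonormal_for J o -> orthonormal_for J o' -> multilinear4 q ->
  \sum_i \sum_j q (o i) (o j) (o i) (o j) = \sum_i \sum_j q (o' i) (o' j) (o' i) (o' j).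
Proof.
move=> on on' [h1 h2 h3 h4].
transitivity (\sum_i \sum_j q (o i) (o' j) (o i) (o' j)).
  by apply: eq_bigr => i _;
    apply: (contraction_orthonormal J o o' (fun X Y => q (o i) X (o i) Y)) => // *.
rewrite exchange_big [RHS]exchange_big; apply: eq_bigr => j _.
by apply: (contraction_orthonormal J o o' (fun X Y => q X (o' j) Y (o' j))) => // *.
Qed.

Lemma mxtrace_orthonormal J o M : orthonormal_for J o ->
  \tr M = \sum_k gJ J (o k) (M *m o k).
Proof.
move=> /colmx_gram e; rewrite -[M in LHS]mul1mx -e -!mulmxA mxtrace_mulC.
apply: eq_bigr => k _; rewrite gramE -!mulmxA !mxE; apply: eq_bigr => i _.
rewrite !mxE; congr (_ * _); apply: eq_bigr => j _; congr (_ * _).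
by rewrite !mxE; apply: eq_bigr => l _; rewrite !mxE.
Qed.

Lemma orthonormal_expansion J o Z : orthonormal_for J o ->
  Z = \sum_k gJ J (o k) Z *: o k.
Proof.
move=> /colmx_gram e; rewrite -[LHS]mul1mx -e -!mulmxA.
apply/matrixP => i j; rewrite ord1 summxE mxE; apply: eq_bigr => k _.
rewrite [RHS]mxE gramE -mulmxA mulrC !mxE; congr (_ * _).
by apply: eq_bigr => l _; rewrite !mxE.
Qed.

Lemma mulJJ J X : JR2 J -> J *m (J *m X) = - X.
Proof. by move=> [J2 _]; rewrite mulmxA J2 mulNmx mul1mx. Qed.

Lemma gJ_sym J X Y : JR2 J -> gJ J X Y = gJ J Y X.
Proof. by move=> /JR2E[d _ _]; rewrite !gJE d; ring. Qed.

Lemma gJDr J (c : R) X Y Y' : gJ J X (c *: Y + Y') = c * gJ J X Y + gJ J X Y'.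
Proof. by rewrite !gJE !mxE; ring. Qed.

Lemma gJ_inj J M M' : JR2 J ->
  (forall X Y, gJ J (M *m X) Y = gJ J (M' *m X) Y) -> M = M'.
Proof.
move=> JJ h.
have on := onb_orthonormal_for J JJ.
suff E X : M *m X = M' *m X.
  apply/matrixP => i j; have := E (bvec j); rewrite /bvec -!colE => /matrixP/(_ i 0).
  by rewrite !mxE.
rewrite (orthonormal_expansion _ _ (M *m X) on) [RHS](orthonormal_expansion _ _ (M' *m X) on).
by apply: eq_bigr => k _; rewrite gJ_sym // h gJ_sym.
Qed.

Lemma sharp_linearl J T (c : R) X X' Y : JR2 J ->
  sharp J T (c *: X + X') Y = c *: sharp J T X Y + sharp J T X' Y.
Proof.
move=> JJ; apply: (gJ_inj J) => // Z W; have [h _ _ _] := teval_multilinear T.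
by rewrite mulmxDl -scalemxAl [RHS]gJ_sym // gJDr !(gJ_sym J W) // !sharpP.
Qed.

Lemma sharp_linearr J T (c : R) X Y Y' : JR2 J ->
  sharp J T X (c *: Y + Y') = c *: sharp J T X Y + sharp J T X Y'.
Proof.
move=> JJ; apply: (gJ_inj J) => // Z W; have [_ h _ _] := teval_multilinear T.
by rewrite mulmxDl -scalemxAl [RHS]gJ_sym // gJDr !(gJ_sym J W) // !sharpP.
Qed.

Lemma mxtrace_sharp J T o X Y : JR2 J -> orthonormal_for J o ->
  \tr (sharp J T X Y) = \sum_k teval T X Y (o k) (o k).
Proof.
move=> JJ on; rewrite (mxtrace_orthonormal _ _ _ on); apply: eq_bigr => k _.
by rewrite gJ_sym // sharpP.
Qed.

Lemma mxtrace_sharp_mul J T T' o X Y X' Y' : JR2 J -> orthonormal_for J o ->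
  \tr (sharp J T X Y *m sharp J T' X' Y') =
  \sum_k \sum_l teval T X Y (o l) (o k) * teval T' X' Y' (o k) (o l).
Proof.
move=> JJ on; rewrite (mxtrace_orthonormal _ _ _ on); apply: eq_bigr => k _.
rewrite -mulmxA (orthonormal_expansion _ _ (sharp J T' X' Y' *m o k) on) mulmx_sumr.
rewrite sum2 -!scalemxAr -[_ *: (_ *m o 1)]addr0 !gJDr.
have -> : gJ J (o k) 0 = 0 by rewrite gJE !mxE; ring.
rewrite addr0 sum2 !(gJ_sym J (o _) (sharp _ _ _ _ *m _)) // !sharpP //.
by congr (_ + _); rewrite mulrC.
Qed.

(** For s = tr M / 2 and s' = tr M' / 2 one has
    tr ((M - s) (M' - s')) - tr (s s') = tr (M M') - tr M tr M'. *)
Lemma innerV_traces J (V V' : vect -> vect -> endo) :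
  innerV J (tf_part V) (tf_part V') - innerV J (tr_part V) (tr_part V') =
  4^-1 * \sum_i \sum_j (\tr (V (onb J i) (onb J j) *m V' (onb J i) (onb J j))
     - \tr (V (onb J i) (onb J j)) * \tr (V' (onb J i) (onb J j))).
Proof.
rewrite /innerV -mulrBr -sumrB; congr (_ * _); apply: eq_bigr => i _.
rewrite -sumrB; apply: eq_bigr => j _; rewrite /tf_part /tr_part.
set M := V _ _; set M' := V' _ _.
rewrite mulmxBl !mulmxBr !mul_mx_scalar !mul_scalar_mx !raddfB /= !mxtraceZ.
rewrite !mxtrace_scalar !mulr2n.
by move: (\tr (M *m M')) (\tr M) (\tr M') => a b c; field.
Qed.

End LinearAlgebra.

(** * The global chart *)

Local Notation i0 := (@Ordinal 4 0 isT).
Local Notation i1 := (@Ordinal 4 1 isT).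
Local Notation i2 := (@Ordinal 4 2 isT).
Local Notation i3 := (@Ordinal 4 3 isT).

Section Chart.
Context {R : realType}.
Notation vect := 'cV[R]_2.
Notation endo := 'M[R]_2.
Notation tens := 'M[R]_(2 * 2).
Notation coords := 'rV[R]_4.
Implicit Types (T : tens) (x u v w : coords) (X Y Z W : vect).

(** A symmetric tensor on the plane is given by its values t n on n copies of e_2
    and 4 - n copies of e_1. *)
Definition symt (t : nat -> R) : tens :=
  \matrix_(p, q) mxvec (\matrix_(i < 2, j < 2)
    mxvec (\matrix_(k < 2, l < 2) t (i + j + k + l)%N) 0 q) 0 p.

Lemma symtE t (i j k l : 'I_2) :
  symt t (mxvec_index i j) (mxvec_index k l) = t (i + j + k + l)%N.
Proof. by rewrite mxE mxvecE mxE mxvecE mxE. Qed.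

Lemma teval_symt t X Y Z W : teval (symt t) X Y Z W =
  t 0%N * (X 0 0 * Y 0 0 * Z 0 0 * W 0 0)
  + t 1%N * (X 1 0 * Y 0 0 * Z 0 0 * W 0 0 + X 0 0 * Y 1 0 * Z 0 0 * W 0 0
           + X 0 0 * Y 0 0 * Z 1 0 * W 0 0 + X 0 0 * Y 0 0 * Z 0 0 * W 1 0)
  + t 2%N * (X 1 0 * Y 1 0 * Z 0 0 * W 0 0 + X 1 0 * Y 0 0 * Z 1 0 * W 0 0
           + X 1 0 * Y 0 0 * Z 0 0 * W 1 0 + X 0 0 * Y 1 0 * Z 1 0 * W 0 0
           + X 0 0 * Y 1 0 * Z 0 0 * W 1 0 + X 0 0 * Y 0 0 * Z 1 0 * W 1 0)
  + t 3%N * (X 0 0 * Y 1 0 * Z 1 0 * W 1 0 + X 1 0 * Y 0 0 * Z 1 0 * W 1 0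
           + X 1 0 * Y 1 0 * Z 0 0 * W 1 0 + X 1 0 * Y 1 0 * Z 1 0 * W 0 0)
  + t 4%N * (X 1 0 * Y 1 0 * Z 1 0 * W 1 0).
Proof. by rewrite /teval !sum2 !symtE /=; ring. Qed.

Lemma symt_sym t : totally_symmetric (symt t).
Proof. by move=> X Y Z W; rewrite !teval_symt; split; ring. Qed.

Lemma ltn_sum_ord2 (i j k l : 'I_2) : (i + j + k + l < 5)%N.
Proof. by rewrite (@leq_trans (1 + 1 + 1 + 1).+1) // ltnS !leq_add // -ltnS. Qed.

Lemma symt_ext (t t' : nat -> R) : (forall n, (n < 5)%N -> t n = t' n) -> symt t = symt t'.
Proof.
move=> h; apply: tens_ext => i j k l; rewrite !teval_bvec !symtE h //.
exact: ltn_sum_ord2.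
Qed.

Definition traceless_mx (a b c : R) : endo :=
  \matrix_(i, j) if i == 0 then (if j == 0 then a else b)
                 else (if j == 0 then c else - a).

Definition model_pt (a b c : R) (t : nat -> R) : endo * tens := (traceless_mx a b c, symt t).

(** The real and imaginary parts of w tau^n for tau = x + i y and w = a + i b, which
    are the values of w alpha^4 on basis vectors. *)
Fixpoint wtau (y b x a : R) (n : nat) : R * R :=
  if n is m.+1 then
    (x * (wtau y b x a m).1 - y * (wtau y b x a m).2,
     x * (wtau y b x a m).2 + y * (wtau y b x a m).1)
  else (a, b).

Fixpoint dwtau (y b x a y' b' x' a' : R) (n : nat) : R * R :=
  if n is m.+1 then
    (x' * (wtau y b x a m).1 + x * (dwtau y b x a y' b' x' a' m).1
     - y' * (wtau y b x a m).2 - y * (dwtau y b x a y' b' x' a' m).2,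
     x' * (wtau y b x a m).2 + x * (dwtau y b x a y' b' x' a' m).2
     + y' * (wtau y b x a m).1 + y * (dwtau y b x a y' b' x' a' m).1)
  else (a', b').

(** The coordinates are (y, Im w, Re tau, Re w): in this order multiplication by i
    on C^2 becomes (tau', w') |-> (- i tau', - i w').  The entries of J solve
    alpha (J v) = i alpha (v). *)
Definition chart (x : coords) : endo * tens :=
  model_pt (- (x 0 i2 / x 0 i0)) (- (x 0 i2 ^+ 2 / x 0 i0 + x 0 i0)) (x 0 i0)^-1
     (fun n => (wtau (x 0 i0) (x 0 i1) (x 0 i2) (x 0 i3) n).1).

Definition dchart (x u : coords) : endo * tens :=
  model_pt ((x 0 i2 * u 0 i0 - u 0 i2 * x 0 i0) / x 0 i0 ^+ 2)
     (x 0 i2 ^+ 2 * u 0 i0 / x 0 i0 ^+ 2 - 2 * x 0 i2 * u 0 i2 / x 0 i0 - u 0 i0)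
     (- (u 0 i0 / x 0 i0 ^+ 2))
     (fun n => (dwtau (x 0 i0) (x 0 i1) (x 0 i2) (x 0 i3)
                      (u 0 i0) (u 0 i1) (u 0 i2) (u 0 i3) n).1).

Definition chart_dom : set coords := [set x | 0 < x 0 i0 /\ (x 0 i1 != 0 \/ x 0 i3 != 0)].

Definition chart_coord (i : 'I_4) (x : coords) : R := x 0 i.

Lemma chart_coord_is_diff i x : is_diff x (chart_coord i : coords -> R) (chart_coord i).
Proof.
by apply: linear_is_diff; [move=> c u v; rewrite /chart_coord !mxE | exact: coord_continuous].
Qed.

Lemma chart_dom_open : open chart_dom.
Proof.
have pre (i : 'I_4) (A : set R) : open A -> open [set x : coords | A (x 0 i)].
  by move=> oA; apply: (open_comp (f := fun x : coords => x 0 i)) => // x _;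
     exact: coord_continuous.
have h0 := pre i0 [set r : R | 0 < r] (@open_gt R 0).
have h1 := pre i1 [set r : R | r != 0] (@open_neq R 0).
have h3 := pre i3 [set r : R | r != 0] (@open_neq R 0).
exact: openI h0 (openU h1 h3).
Qed.

Notation tm := (@fterm R 'I_4).
Notation ev := (fval chart_coord id).
Notation adm := (admissible chart_coord id).
Notation y_ := (@TVar R _ i0).
Notation b_ := (@TVar R _ i1).
Notation x_ := (@TVar R _ i2).
Notation a_ := (@TVar R _ i3).

Fixpoint wtau_term (n : nat) : tm * tm :=
  if n is m.+1 then
    (TAdd (TMul x_ (wtau_term m).1) (TMul (TCst (-1)) (TMul y_ (wtau_term m).2)),
     TAdd (TMul x_ (wtau_term m).2) (TMul y_ (wtau_term m).1))
  else (a_, b_).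

Definition chart_term (j : 'I_8) : tm :=
  match val j with
  | 0 => TMul (TCst (-1)) (TMul x_ (TInv y_))
  | 1 => TMul (TCst (-1)) (TAdd (TMul (TMul x_ x_) (TInv y_)) y_)
  | 2 => TInv y_
  | n.+3 => (wtau_term n).1
  end.

Definition chart_basis (j : 'I_8) : endo * tens :=
  model_pt (j == 0 :> nat)%:R (j == 1 :> nat)%:R (j == 2 :> nat)%:R
     (fun n => (n.+3 == j)%:R).

Lemma sum_chart_basis (F : 'I_8 -> R) (s : nat -> R) : (forall j : 'I_8, F j = s j) ->
  \sum_j F j *: chart_basis j = model_pt (s 0%N) (s 1%N) (s 2%N) (fun n => s n.+3).
Proof.
move=> FE; under eq_bigr do rewrite FE.
rewrite !big_ord_recl big_ord0 addr0 /chart_basis /model_pt /= /bump /=.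
apply/pair_equal_spec; split.
  by apply/matrixP => i j; rewrite !mxE; do 2!case: eqP => _; ring.
apply: tens_ext => i j k l; rewrite !teval_bvec !mxE !mxvecE !mxE !mxvecE !mxE.
have := ltn_sum_ord2 i j k l.
by case: (i + j + k + l)%N => [|[|[|[|[|]]]]] //= _; ring.
Qed.

Lemma wtau_termE n x :
  [/\ ev (wtau_term n).1 x = (wtau (x 0 i0) (x 0 i1) (x 0 i2) (x 0 i3) n).1,
      ev (wtau_term n).2 x = (wtau (x 0 i0) (x 0 i1) (x 0 i2) (x 0 i3) n).2,
      adm (wtau_term n).1 x & adm (wtau_term n).2 x].
Proof.
elim: n => [|n [IH1 IH2 IH3 IH4]]; first by split.
by split=> //=; rewrite ?IH1 ?IH2 /chart_coord; ring.
Qed.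

Lemma dwtau_termE n x u :
  fval chart_coord id (dterm chart_coord u (wtau_term n).1) x =
    (dwtau (x 0 i0) (x 0 i1) (x 0 i2) (x 0 i3)
           (u 0 i0) (u 0 i1) (u 0 i2) (u 0 i3) n).1 /\
  fval chart_coord id (dterm chart_coord u (wtau_term n).2) x =
    (dwtau (x 0 i0) (x 0 i1) (x 0 i2) (x 0 i3)
           (u 0 i0) (u 0 i1) (u 0 i2) (u 0 i3) n).2.
Proof.
elim: n => [|n [IH1 IH2]]; first by split.
have [e1 e2 _ _] := wtau_termE n x.
by split; rewrite /= ?IH1 ?IH2 ?e1 ?e2 /chart_coord; ring.
Qed.

Lemma chart_term_comb x : chart x = term_comb chart_coord id chart_basis chart_term x.
Proof.
rewrite /term_comb (sum_chart_basis _ (fun n => match n with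
  | 0 => - (x 0 i2 / x 0 i0) | 1 => - (x 0 i2 ^+ 2 / x 0 i0 + x 0 i0)
  | 2 => (x 0 i0)^-1
  | m.+3 => (wtau (x 0 i0) (x 0 i1) (x 0 i2) (x 0 i3) m).1 end)) //.
move=> [[|[|[|m]]] p]; rewrite /chart_term /= /chart_coord.
- by rewrite mulN1r.
- by rewrite mulN1r expr2.
- by [].
- by have [-> _ _ _] := wtau_termE m x.
Qed.

Lemma chart_admissible x j : chart_dom x -> adm (chart_term j) x.
Proof.
move=> [y0 _]; have n0 : x 0 i0 != 0 by rewrite gt_eqF.
case: j => [[|[|[|m]]] p]; rewrite /chart_term /=; try by do ?split.
by have [_ _ ? _] := wtau_termE m x.
Qed.

Lemma derive_chart x u : chart_dom x -> 'D_u chart x = dchart x u.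
Proof.
move=> xO; have [y0 _] := xO; have n0 : x 0 i0 != 0 by rewrite gt_eqF.
rewrite (_ : chart = term_comb chart_coord id chart_basis chart_term); last first.
  exact/funext/chart_term_comb.
have d := term_comb_is_diff chart_coord id chart_coord_is_diff chart_basis chart_term x
  (fun j => chart_admissible x j xO).
rewrite deriveE ?diff_val; last exact: (@ex_diff _ _ _ _ _ _ _ d).
rewrite /term_comb (sum_chart_basis _ (fun n => match n with
  | 0 => (x 0 i2 * u 0 i0 - u 0 i2 * x 0 i0) / x 0 i0 ^+ 2
  | 1 => x 0 i2 ^+ 2 * u 0 i0 / x 0 i0 ^+ 2 - 2 * x 0 i2 * u 0 i2 / x 0 i0 - u 0 i0
  | 2 => - (u 0 i0 / x 0 i0 ^+ 2)
  | m.+3 => (dwtau (x 0 i0) (x 0 i1) (x 0 i2) (x 0 i3)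
                      (u 0 i0) (u 0 i1) (u 0 i2) (u 0 i3) m).1 end)) //.
move=> [[|[|[|m]]] p]; rewrite /chart_term /= /chart_coord; try by field.
by have [-> _] := dwtau_termE m x u.
Qed.

Lemma chart_smooth : smooth_on chart_dom chart.
Proof.
apply: (smooth_on_term_comb chart_coord id chart_coord_is_diff _ _
  chart_basis chart_term) => //.
- exact: chart_dom_open.
- by move=> x j; exact: chart_admissible.
- by move=> x _; exact: chart_term_comb.
Qed.

Definition ambient_coord (i : 'I_4) (p : endo * tens) : R :=
  match val i with
  | 0 => p.1 0 0
  | 1 => p.1 1 0
  | 2 => p.2 (mxvec_index 0 0) (mxvec_index 0 0)
  | _ => p.2 (mxvec_index 0 0) (mxvec_index 0 1)
  end.

Lemma ambient_coord_is_diff i p :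
  is_diff p (ambient_coord i : endo * tens -> R) (ambient_coord i).
Proof.
apply: linear_is_diff => [c u v|q]; rewrite /ambient_coord.
  by case: i => [[|[|[|m]]] ?] /=; rewrite !mxE.
case: i => [[|[|[|m]]] ?] /=.
- by apply: (@continuous_comp _ _ _ fst (fun M : endo => M 0 0) q);
    [exact: cvg_fst | exact: coord_continuous].
- by apply: (@continuous_comp _ _ _ fst (fun M : endo => M 1 0) q);
    [exact: cvg_fst | exact: coord_continuous].
- by apply: (@continuous_comp _ _ _ snd (fun T : tens => T _ _) q);
    [exact: cvg_snd | exact: coord_continuous].
- by apply: (@continuous_comp _ _ _ snd (fun T : tens => T _ _) q);
    [exact: cvg_snd | exact: coord_continuous].
Qed.

(** As alpha (e_1) = 1 and J e_1 = a e_1 + c e_2, tau solves a + c tau = i; moreover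
    T (e_1, e_1, e_1, e_1) = Re w and T (e_1, e_1, e_1, J e_1) = - Im w. *)
Definition chart_inv (p : endo * tens) : coords :=
  \row_j match val j with
  | 0 => (p.1 1 0)^-1
  | 1 => - (p.1 0 0 * ambient_coord i2 p + p.1 1 0 * ambient_coord i3 p)
  | 2 => - (p.1 0 0 / p.1 1 0)
  | _ => ambient_coord i2 p
  end.

Lemma J10_gt0_open : open [set p : endo * tens | 0 < p.1 1 0].
Proof.
apply: (open_comp (f := ambient_coord i1) (D := [set r : R | 0 < r])) => [p _|].
  have d := ambient_coord_is_diff i1 p.
  exact: differentiable_continuous (@ex_diff _ _ _ _ _ _ _ d).
exact: open_gt.
Qed.

Definition chart_inv_term (j : 'I_4) : tm :=
  match val j with
  | 0 => TInv (TVar i1)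
  | 1 => TMul (TCst (-1)) (TAdd (TMul (TVar i0) (TVar i2)) (TMul (TVar i1) (TVar i3)))
  | 2 => TMul (TCst (-1)) (TMul (TVar i0) (TInv (TVar i1)))
  | _ => TVar i2
  end.

Lemma chart_inv_smooth : smooth_on [set p : endo * tens | 0 < p.1 1 0] chart_inv.
Proof.
apply: (smooth_on_term_comb ambient_coord id ambient_coord_is_diff _ _
  (fun j : 'I_4 => delta_mx 0 j) chart_inv_term).
- exact: J10_gt0_open.
- move=> p [[|[|[|m]]] ?] /= p0; do ?split=> //=; by rewrite gt_eqF.
- move=> p _; rewrite [LHS]row_sum_delta /term_comb; apply: eq_bigr => j _.
  congr (_ *: _); rewrite mxE.
  by case: j => [[|[|[|m]]] ?]; rewrite /chart_inv_term /= ?mulN1r.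
Qed.

Lemma chartK x : chart_dom x -> chart_inv (chart x) = x.
Proof.
move=> [y0 _]; have n0 : x 0 i0 != 0 by rewrite gt_eqF.
apply/rowP => j; rewrite mxE /ambient_coord /chart /model_pt /= !symtE.
rewrite ![traceless_mx _ _ _ _ _]mxE /=.
case: j => [[|[|[|[|m]]]] q] //=; rewrite ?invrK.
- by congr (x 0 _); exact: val_inj.
- by rewrite [RHS](_ : _ = x 0 i1); [field | congr (x 0 _); exact: val_inj].
- by rewrite [RHS](_ : _ = x 0 i2); [field | congr (x 0 _); exact: val_inj].
- by congr (x 0 _); exact: val_inj.
Qed.

End Chart.

Section Image.
Context {R : realType}.
Notation vect := 'cV[R]_2.
Notation endo := 'M[R]_2.
Notation tens := 'M[R]_(2 * 2).
Notation coords := 'rV[R]_4.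
Implicit Types (T : tens) (x u v w : coords) (X Y Z W : vect).

Lemma traceless_mx_mul (a b c : R) X :
  ((traceless_mx a b c *m X) 0 0 = a * X 0 0 + b * X 1 0) *
  ((traceless_mx a b c *m X) 1 0 = c * X 0 0 - a * X 1 0).
Proof. by split; rewrite !mxE !sum2 !mxE /= ?mulNr. Qed.

Lemma JR2_traceless_mx (a b c : R) : a ^+ 2 + b * c = -1 -> 0 < c -> JR2 (traceless_mx a b c).
Proof.
move=> e c0; have e' : b * c = -1 - a ^+ 2 by rewrite -e; ring.
split.
  apply/matrixP => i j; rewrite !mxE !sum2 !mxE.
  case: i => [[|[|//]] ?]; case: j => [[|[|//]] ?] /=; rewrite ?mulr0n ?mulr1n;
    ring: e'.
exists (bvec 0).
  by apply/eqP => /matrixP/(_ 0 0); rewrite !mxE /=; apply/eqP; rewrite oner_eq0.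
by rewrite /rho0 !traceless_mx_mul !mxE /= !(mulr1, mulr0, mul1r, mul0r, subr0).
Qed.

Lemma JR2_chart x : chart_dom x -> JR2 (chart x).1.
Proof.
move=> [y0 _]; have n0 : x 0 i0 != 0 by rewrite gt_eqF.
by apply: JR2_traceless_mx; [field | rewrite invr_gt0].
Qed.

Lemma chart_MR2star x : chart_dom x -> MR2star (chart x).
Proof.
move=> xO; have [y0 w0] := xO; have n0 : x 0 i0 != 0 by rewrite gt_eqF.
split; first split; first exact: JR2_chart.
- exact: symt_sym.
- by move=> X Y Z W; rewrite /= !teval_symt !traceless_mx_mul /=; field.
apply/eqP => /matrixP T0.
have := T0 (mxvec_index 0 0) (mxvec_index 0 0).
have := T0 (mxvec_index 0 0) (mxvec_index 0 1).
rewrite !symtE /= !mxE => e1 e2; move: e1; rewrite e2 mulr0 add0r => /eqP.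
rewrite oppr_eq0 mulf_eq0 (negbTE n0) /= => /eqP e3.
by move: w0; rewrite e2 e3 eqxx; case.
Qed.

Lemma symt_of_sym T : totally_symmetric T -> exists t, T = symt t.
Proof.
move=> sT.
pose e (c : bool) : 'I_2 := if c then 1 else 0.
pose E (i j k l : 'I_2) := teval T (bvec i) (bvec j) (bvec k) (bvec l).
have s12 k l : E 1 0 k l = E 0 1 k l.
  by rewrite /E; case: (sT (bvec 0) (bvec 1) (bvec k) (bvec l)).
have s23 k l : E k 1 0 l = E k 0 1 l.
  by rewrite /E; case: (sT (bvec k) (bvec 0) (bvec 1) (bvec l)).
have s34 k l : E k l 1 0 = E k l 0 1.
  by rewrite /E; case: (sT (bvec k) (bvec l) (bvec 0) (bvec 1)).
exists (fun n => E (e (3 < n)%N) (e (2 < n)%N) (e (1 < n)%N) (e (0 < n)%N)).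
apply: tens_ext => i j k l; rewrite [RHS]teval_bvec symtE -/(E i j k l).
by case: (ord2P i) => ->; case: (ord2P j) => ->; case: (ord2P k) => ->; case: (ord2P l) => ->;
  rewrite /= ?(s12, s23, s34).
Qed.

(** Evaluated on (e_1, e_1, ., .), the condition T (J ., J ., ., .) = - T is the
    recursion t_(n+2) = 2 Re tau t_(n+1) - |tau|^2 t_n, which determines t by t_0 and
    t_1; the sequence Re (w tau^n) satisfies it as well. *)
Lemma MR2star_chart (p : endo * tens) : MR2star p ->
  exists2 x : coords, chart_dom x & chart x = p.
Proof.
case: p => J T [[/= JJ sT antiT] T0].
have [d e c0] := JR2E JJ; have n0 : J 1 0 != 0 by rewrite gt_eqF.
have [t Tt] := symt_of_sym T sT.
set a := J 0 0 in d e; set b := J 0 1 in e; set c := J 1 0 in c0 e n0.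
have bE : b = - (1 + a ^+ 2) / c by apply: (mulIf n0); rewrite divfK // -[1]opprK -e; ring.
have JE : J = traceless_mx a b c.
  apply/matrixP => i j; rewrite !mxE.
  by case: i => [[|[|//]] ?]; case: j => [[|[|//]] ?] /=; rewrite -?d;
    congr (J _ _); exact: val_inj.
have rec n : (n < 3)%N ->
    t n.+2 = - 2 * (a / c) * t n.+1 - (1 + a ^+ 2) / c ^+ 2 * t n.
  move=> n3.
  have h := antiT (bvec 0) (bvec 0) (bvec (if (1 < n)%N then 1 else 0))
                  (bvec (if (0 < n)%N then 1 else 0)).
  move: h; rewrite Tt !teval_symt JE !traceless_mx_mul !mxE /=.
  move=> h; have h' : t n.+2 * c ^+ 2 = - (1 + a ^+ 2) * t n - 2 * a * c * t n.+1.
    by case: n n3 h => [|[|[|//]]] _ /= h; lra.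
  by apply: (mulIf (expf_neq0 2 n0)); rewrite h'; field.
exists (chart_inv (J, T)); rewrite /chart_inv /ambient_coord /= Tt !symtE /=.
  rewrite /chart_dom /= !mxE /= invr_gt0; split=> //.
  have [t00|] := eqVneq (t 0%N) 0; last by right.
  have [t10|t1n] := eqVneq (t 1%N) 0; last first.
    by left; rewrite t00 mulr0 add0r oppr_eq0 mulf_neq0.
  case/eqP: T0; rewrite Tt; apply: tens_ext => i j k l; rewrite !teval_bvec symtE !mxE.
  have t2 : t 2%N = 0 by rewrite rec // t00 t10; ring.
  have t3 : t 3%N = 0 by rewrite rec // t2 t10; ring.
  have t4 : t 4%N = 0 by rewrite rec // t2 t3; ring.
  by case: i => [[|[|//]] ?]; case: j => [[|[|//]] ?]; case: k => [[|[|//]] ?];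
     case: l => [[|[|//]] ?].
rewrite /chart !mxE /=; congr (_, _).
  by rewrite JE !mxE /= -/a -/b -/c bE; congr traceless_mx; field.
apply: symt_ext => n n5; rewrite -/a -/c !addn0 !add0n modn_small //.
have t2 := rec 0%N isT; have t3 := rec 1%N isT; have t4 := rec 2%N isT.
case: n n5 => [|[|[|[|[|//]]]]] _ /=; first by [].
- by field.
- by rewrite t2; field.
- by rewrite t3 t2; field.
- by rewrite t4 t3 t2; field.
Qed.

Lemma chart_image : @chart R @` chart_dom = MR2star.
Proof.
apply/seteqP; split=> [_ [x xO <-]|p Mp]; first exact: chart_MR2star.
by have [x xO <-] := MR2star_chart p Mp; exists x.
Qed.

Lemma MR2star_gt0 (p : endo * tens) : MR2star p -> 0 < p.1 1 0.
Proof. by move=> [[/JR2E[]]]. Qed.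

Lemma chart_local_param :
  local_param (@MR2star R) (chart_dom : set 'rV[R]_(1 + 1.+1).+1) chart.
Proof.
exists [set p : endo * tens | 0 < p.1 1 0], chart_inv; split; first split.
- exact: chart_dom_open.
- exact: J10_gt0_open.
- by rewrite chart_image; apply/esym/setIidPl => p; exact: MR2star_gt0.
- split; first exact: chart_smooth.
    exact: chart_inv_smooth.
  by move=> x; exact: chartK.
Qed.

Lemma tangent_chart x : chart_dom x ->
  tangent (@MR2star R) (chart x) = range (dchart x).
Proof.
move=> xO; rewrite (tangent_local_param _ _ _ _ _ chart_local_param) //.
by suff -> : (fun u => 'D_u chart x) = dchart x by []; apply/funext => u; rewrite derive_chart.
Qed.

End Image.

(** * The metric and the complex structure in the chart *)

Section Formulas.
Context {R : realType}.
Notation vect := 'cV[R]_2.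
Notation endo := 'M[R]_2.
Notation tens := 'M[R]_(2 * 2).
Notation coords := 'rV[R]_4.
Implicit Types (T : tens) (x u v w : coords) (X Y Z W : vect).

(** The real and imaginary parts of y^2 (w' - 2 i w tau' / y). *)
Definition Dw_re x u : R :=
  x 0 i0 ^+ 2 * u 0 i3 + 2 * x 0 i0 * (x 0 i3 * u 0 i0 + x 0 i1 * u 0 i2).
Definition Dw_im x u : R :=
  x 0 i0 ^+ 2 * u 0 i1 - 2 * x 0 i0 * (x 0 i3 * u 0 i2 - x 0 i1 * u 0 i0).
Definition half_normU2 x : R := (x 0 i3 ^+ 2 + x 0 i1 ^+ 2) * x 0 i0 ^+ 4.

(** The value Re (i^n (y^2 w' - n i w y tau')) of T' on n copies of J o and 4 - n
    copies of o = sqrt y e_1: on o and J o, alpha takes the values sqrt y and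
    i sqrt y, and its variation tau' dy_0 the values 0 and tau' / sqrt y. *)
Definition frame_coef x u (n : nat) : R :=
  let p := x 0 i0 ^+ 2 * u 0 i3 in
  let q := x 0 i0 ^+ 2 * u 0 i1 in
  let s := x 0 i0 * (x 0 i3 * u 0 i2 - x 0 i1 * u 0 i0) in
  let z := x 0 i0 * (x 0 i3 * u 0 i0 + x 0 i1 * u 0 i2) in
  match n with
  | 0 => p | 1 => - q + s | 2 => - p - 2 * z | 3 => q - 3 * s | _ => p + 4 * z
  end.

Lemma onb_chart x : chart_dom x -> exists2 r : R, r ^+ 2 = x 0 i0 &
  ((onb (chart x).1 0 0 0 = r) * (onb (chart x).1 0 1 0 = 0) *
  (onb (chart x).1 1 0 0 = - (r * (x 0 i2 / x 0 i0))) *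
  (onb (chart x).1 1 1 0 = r / x 0 i0))%type.
Proof.
move=> [y0 _]; have n0 : x 0 i0 != 0 by rewrite gt_eqF.
exists (Num.sqrt (gJ (chart x).1 (bvec 0) (bvec 0)))^-1.
  rewrite exprVn sqr_sqrtr; rewrite gJE !mxE /= ; first by field.
  by rewrite !(mulr1, mulr0, mul1r, mul0r, addr0, subr0) invr_ge0 ltW.
by rewrite /onb /onb1 /= !traceless_mx_mul !mxE /=; do !split; ring.
Qed.

Lemma teval_dchart_onb x u : chart_dom x -> forall i j k l : 'I_2,
  teval (dchart x u).2 (onb (chart x).1 i) (onb (chart x).1 j)
                       (onb (chart x).1 k) (onb (chart x).1 l)
  = frame_coef x u (i + j + k + l)%N.
Proof.
move=> xO; have [r r2 o] := onb_chart x xO.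
have [y0 _] := xO; have n0 : x 0 i0 != 0 by rewrite gt_eqF.
have r4 : r * r * r * r = x 0 i0 ^+ 2 by rewrite -r2; ring.
move=> i j k l; rewrite teval_symt /frame_coef; set y := x 0 i0 in n0 r4 o *.
case: (ord2P i) => ->; case: (ord2P j) => ->; case: (ord2P k) => ->; case: (ord2P l) => ->;
  rewrite !o /=; field: r4 => //.
Qed.

(** T is linear in w, hence it is its own derivative in the direction w. *)
Definition euler x : coords := \row_j if (j == i1) || (j == i3) then x 0 j else 0.

Lemma chart2_euler x : (chart x).2 = (dchart x (euler x)).2.
Proof.
apply: symt_ext => n _; rewrite !mxE /=.
move: (x 0 i0) (x 0 i1) (x 0 i2) (x 0 i3) => y b xx a.
suff -> : dwtau y b xx a 0 b 0 a n = wtau y b xx a n by [].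
by elim: n => //= n ->; congr (_, _); ring.
Qed.

Lemma normU2_chart x : chart_dom x -> normU2 (chart x) = 2 * half_normU2 x.
Proof.
move=> xO; have JJ := JR2_chart x xO.
rewrite /normU2 /innerV /Uof !sum2 chart2_euler.
rewrite !(mxtrace_sharp_mul _ _ _ _ _ _ _ _ JJ (onb_orthonormal_for _ JJ)).
by rewrite !sum2 !teval_dchart_onb // /frame_coef !mxE /= /half_normU2; field.
Qed.

(** The part of T' of type alpha^3 conj alpha contributes equally to both terms, so
    that only the coefficient of alpha^4 remains. *)
Lemma innerV_dchart x u v : chart_dom x ->
  innerV (chart x).1 (tf_part (dU (chart x) (dchart x u)))
                     (tf_part (dU (chart x) (dchart x v)))
  - innerV (chart x).1 (tr_part (dU (chart x) (dchart x u)))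
                       (tr_part (dU (chart x) (dchart x v)))
  = 2 * (Dw_re x u * Dw_re x v + Dw_im x u * Dw_im x v).
Proof.
move=> xO; have JJ := JR2_chart x xO.
rewrite innerV_traces /dU !sum2.
rewrite !(mxtrace_sharp_mul _ _ _ _ _ _ _ _ JJ (onb_orthonormal_for _ JJ)).
rewrite !(mxtrace_sharp _ _ _ _ _ JJ (onb_orthonormal_for _ JJ)).
rewrite !sum2 !teval_dchart_onb //= /frame_coef /Dw_re /Dw_im.
by field.
Qed.

Definition g_chart (f : R -> R) x u v : R :=
  (1 - f (half_normU2 x)) * ((u 0 i0 * v 0 i0 + u 0 i2 * v 0 i2) / x 0 i0 ^+ 2)
  + hl_derive f (half_normU2 x) * (Dw_re x u * Dw_re x v + Dw_im x u * Dw_im x v).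

Lemma g_f_chart f x u v : chart_dom x ->
  g_f f (chart x) (dchart x u) (dchart x v) = g_chart f x u v.
Proof.
move=> xO; have [y0 _] := xO; have n0 : x 0 i0 != 0 by rewrite gt_eqF.
rewrite /g_f /g_chart innerV_dchart // normU2_chart // mulrAC mulfV ?mul1r ?pnatr_eq0 //.
congr (_ * _ + _); last by field.
by rewrite /innerJ /mxtrace !sum2 !mxE !sum2 !mxE /=; field.
Qed.

Lemma mul_iE (u : coords) :
  (((@mul_i R 1 u) 0 i0 = - u 0 i2) * ((@mul_i R 1 u) 0 i1 = - u 0 i3) *
  ((@mul_i R 1 u) 0 i2 = u 0 i0) * ((@mul_i R 1 u) 0 i3 = u 0 i1))%type.
Proof.
have e0 : i0 = lshift 2 (0 : 'I_2) by exact: val_inj.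
have e1 : i1 = lshift 2 (1 : 'I_2) by exact: val_inj.
have e2 : i2 = rshift 2 (0 : 'I_2) by exact: val_inj.
have e3 : i3 = rshift 2 (1 : 'I_2) by exact: val_inj.
rewrite /mul_i e0 e1 e2 e3 !(@row_mxEl _ 1 2 2) !(@row_mxEr _ 1 2 2).
by do !split; rewrite !mxE.
Qed.

(** The dualities flat and sharp cancel, which leaves an expression in T and T'. *)
Lemma Istr2E (p v : endo * tens) : JR2 p.1 -> (Istr p v).2 =
  tensor_of (fun X Y Z W => - teval v.2 X Y (p.1 *m Z) W - teval p.2 X Y (v.1 *m Z) W).
Proof.
move=> JJ; rewrite /Istr /flat /=; congr tensor_of.
apply/funext => X; apply/funext => Y; apply/funext => Z; apply/funext => W.
rewrite -(sharpP p.2 X Y _ W JJ) -(sharpP v.2 X Y _ W JJ) mulmxBl mulNmx -!mulmxA.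
by rewrite !gJE !mxE; ring.
Qed.

Lemma teval_Istr (p v : endo * tens) X Y Z W : JR2 p.1 -> teval (Istr p v).2 X Y Z W =
  - teval v.2 X Y (p.1 *m Z) W - teval p.2 X Y (v.1 *m Z) W.
Proof.
move=> JJ; rewrite Istr2E // teval_tensor_of //.
have [h1 h2 h3 h4] := teval_multilinear v.2.
have [k1 k2 k3 k4] := teval_multilinear p.2.
split=> *; rewrite ?mulmxDr -?scalemxAr.
- by rewrite h1 k1; ring.
- by rewrite h2 k2; ring.
- by rewrite h3 k3; ring.
- by rewrite h4 k4; ring.
Qed.

(** T (., ., J ., .) is the real part of i q, so the tensor component of I is the real
    part of - i q'. *)
Lemma Istr_chart x u : chart_dom x ->
  Istr (chart x) (dchart x u) = dchart x (@mul_i R 1 u).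
Proof.
move=> xO; have [y0 _] := xO; have n0 : x 0 i0 != 0 by rewrite gt_eqF.
have JJ := JR2_chart x xO.
rewrite [LHS]surjective_pairing [RHS]surjective_pairing; congr (_, _).
  rewrite /= !mul_iE; apply/matrixP => i j; rewrite !mxE !sum2 !mxE.
  by case: i => [[|[|//]] ?]; case: j => [[|[|//]] ?] /=; field.
apply: tens_ext => i j k l; rewrite teval_Istr //.
rewrite [RHS]teval_bvec [LHS]/= !teval_symt !traceless_mx_mul symtE !mul_iE !mxE.
by case: i => [[|[|//]] ?]; case: j => [[|[|//]] ?]; case: k => [[|[|//]] ?];
   case: l => [[|[|//]] ?]; rewrite /=; field.
Qed.

End Formulas.

(** * Nondegeneracy and closedness *)

Section Kahler.
Context {R : realType}.
Variable f : R -> R.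
Hypothesis f_smooth : hl_smooth f.
Notation vect := 'cV[R]_2.
Notation endo := 'M[R]_2.
Notation tens := 'M[R]_(2 * 2).
Notation coords := 'rV[R]_4.
Implicit Types (x u v w : coords).
Notation tm := (@fterm R 'I_4).
Notation ev := (fval chart_coord f).
Notation adm := (admissible chart_coord f).
Notation y_ := (@TVar R _ i0).
Notation b_ := (@TVar R _ i1).
Notation x_ := (@TVar R _ i2).
Notation a_ := (@TVar R _ i3).

Lemma locally_param_chart
    (Q : set 'rV[R]_(1 + 1.+1).+1 -> ('rV[R]_(1 + 1.+1).+1 -> endo * tens) -> Prop) :
  Q chart_dom chart -> locally_param (@MR2star R) Q.
Proof.
move=> Qchart p; rewrite -chart_image => -[x xO <-]; rewrite chart_image.
by exists chart_dom, chart; split; [exact: chart_local_param | exists x | ].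
Qed.

Lemma tangentP (p v : endo * tens) : MR2star p -> tangent (@MR2star R) p v ->
  exists2 x, chart_dom x & p = chart x /\ exists u, v = dchart x u.
Proof.
rewrite -chart_image => -[x xO <-]; rewrite chart_image.
by rewrite tangent_chart // => -[u _ <-]; exists x => //; split=> //; exists u.
Qed.

Lemma tangent_dchart (v : endo * tens) x : chart_dom x ->
  tangent (@MR2star R) (chart x) v -> exists u, v = dchart x u.
Proof. by move=> xO; rewrite tangent_chart // => -[u _ <-]; exists u. Qed.

Lemma dchart_linear x (c : R) u v : chart_dom x ->
  c *: dchart x u + dchart x v = dchart x (c *: u + v).
Proof.
move=> xO; have d : differentiable chart x by exact: (chart_smooth [::] x xO).
by rewrite -!derive_chart // !deriveE // linearP.
Qed.

Lemma dchart0 x : chart_dom x -> dchart x 0 = 0.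
Proof. by move=> xO; rewrite -derive_chart // derive0. Qed.

Lemma g_chartDl x (c : R) u v w :
  g_chart f x (c *: u + v) w = c * g_chart f x u w + g_chart f x v w.
Proof. by rewrite /g_chart /Dw_re /Dw_im !mxE; ring. Qed.

Lemma g_chart_sym x u v : g_chart f x u v = g_chart f x v u.
Proof. by rewrite /g_chart; ring. Qed.

Lemma g_chart_mul_i x u v :
  g_chart f x (@mul_i R 1 u) (@mul_i R 1 v) = g_chart f x u v.
Proof. by rewrite /g_chart /Dw_re /Dw_im !mul_iE; ring. Qed.

Lemma mul_i_linear (c : R) u v :
  @mul_i R 1 (c *: u + v) = c *: @mul_i R 1 u + @mul_i R 1 v.
Proof.
rewrite /mul_i scale_row_mx add_row_mx scalerN -opprD.
by congr row_mx; rewrite ?linearP.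
Qed.

Lemma mul_iK u : @mul_i R 1 (@mul_i R 1 u) = - u.
Proof.
by rewrite /mul_i row_mxKl row_mxKr -opp_row_mx; congr (- _); exact: hsubmxK.
Qed.

Lemma half_normU2_gt0 x : chart_dom x -> 0 < half_normU2 x.
Proof.
move=> [y0 w0]; rewrite /half_normU2 mulr_gt0 ?exprn_gt0 // lt_def addr_ge0 ?sqr_ge0 // andbT.
rewrite paddr_eq0 ?sqr_ge0 // !sqrf_eq0 negb_and orbC.
by case: w0 => ->; rewrite ?orbT.
Qed.

(** The metric is positive in tau' and negative in the covariant derivative Dw of w,
    and these two are coordinates on the tangent space.  The vector v with the same
    tau' as u and opposite Dw thus makes g(u, v) a sum of two nonnegative terms. *)
Lemma g_chart_nondegenerate x u : chart_dom x ->
  (forall t : R, 0 <= t -> f t <= 0) -> (forall t : R, 0 <= t -> hl_derive f t < 0) ->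
  (forall v, g_chart f x u v = 0) -> u = 0.
Proof.
move=> xO f_le0 f'_lt0 h; have q0 := ltW (half_normU2_gt0 x xO).
have [y0 _] := xO; have n0 : x 0 i0 != 0 by rewrite gt_eqF.
(* z1 + i z2 is the w-component of v for which Dw (v) = - Dw (u). *)
pose z1 := - (2 * (x 0 i3 * u 0 i0 + x 0 i1 * u 0 i2) / x 0 i0 + Dw_re x u / x 0 i0 ^+ 2).
pose z2 := 2 * (x 0 i3 * u 0 i2 - x 0 i1 * u 0 i0) / x 0 i0 - Dw_im x u / x 0 i0 ^+ 2.
pose v : coords := \row_j match val j with 0 => u 0 i0 | 1 => z2 | 2 => u 0 i2 | _ => z1 end.
have e1 : Dw_re x v = - Dw_re x u by rewrite {1}/Dw_re /v !mxE /= /z1; field.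
have e2 : Dw_im x v = - Dw_im x u by rewrite {1}/Dw_im /v !mxE /= /z2; field.
have := h v; rewrite /g_chart e1 e2 /v !mxE /=.
set k1 := 1 - f (half_normU2 x); set k2 := hl_derive f (half_normU2 x).
have k10 : 0 < k1 by rewrite subr_gt0 (le_lt_trans (f_le0 _ q0)).
have k20 : k2 < 0 by exact: f'_lt0.
have -> : k1 * ((u 0 i0 * u 0 i0 + u 0 i2 * u 0 i2) / x 0 i0 ^+ 2) +
  k2 * (Dw_re x u * - Dw_re x u + Dw_im x u * - Dw_im x u) =
  k1 * ((u 0 i0 ^+ 2 + u 0 i2 ^+ 2) / x 0 i0 ^+ 2)
  + (- k2) * (Dw_re x u ^+ 2 + Dw_im x u ^+ 2).
  by ring.
move/eqP; rewrite paddr_eq0; last 2 first.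
- by rewrite mulr_ge0 ?(ltW k10) // divr_ge0 ?addr_ge0 ?sqr_ge0.
- by rewrite mulr_ge0 ?addr_ge0 ?sqr_ge0 // oppr_ge0 ltW.
rewrite !mulf_eq0 oppr_eq0 (gt_eqF k10) (lt_eqF k20) invr_eq0 sqrf_eq0 (negbTE n0) orbF /=.
rewrite !paddr_eq0 ?sqr_ge0 // !sqrf_eq0.
move=> /andP[/andP[/eqP u0 /eqP u2] /andP[/eqP re0 /eqP im0]].
have u3 : u 0 i3 = 0.
  by apply: (mulfI (expf_neq0 2 n0)); rewrite mulr0 -re0 /Dw_re u0 u2; ring.
have u1 : u 0 i1 = 0.
  by apply: (mulfI (expf_neq0 2 n0)); rewrite mulr0 -im0 /Dw_im u0 u2; ring.
apply/rowP => j; rewrite mxE; case: j => [[|[|[|[|//]]]] p].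
- by rewrite -u0; congr (u 0 _); exact: val_inj.
- by rewrite -u1; congr (u 0 _); exact: val_inj.
- by rewrite -u2; congr (u 0 _); exact: val_inj.
- by rewrite -u3; congr (u 0 _); exact: val_inj.
Qed.

Definition sq (e : tm) := TMul e e.
Definition q_term : tm := TMul (TAdd (sq a_) (sq b_)) (sq (sq y_)).
Definition re_term (u : coords) : tm :=
  TAdd (TMul (sq y_) (TCst (u 0 i3)))
    (TMul (TCst 2) (TMul y_ (TAdd (TMul a_ (TCst (u 0 i0))) (TMul b_ (TCst (u 0 i2)))))).
Definition im_term (u : coords) : tm :=
  TAdd (TMul (sq y_) (TCst (u 0 i1)))
    (TMul (TCst (-2)) (TMul y_ (TAdd (TMul a_ (TCst (u 0 i2))) (TMul b_ (TCst (- u 0 i0)))))).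
Definition g_term (u v : coords) : tm :=
  TAdd (TMul (TAdd (TCst 1) (TMul (TCst (-1)) (TFun 0 q_term)))
             (TMul (TCst (u 0 i0 * v 0 i0 + u 0 i2 * v 0 i2)) (TInv (sq y_))))
       (TMul (TFun 1 q_term)
             (TAdd (TMul (re_term u) (re_term v)) (TMul (im_term u) (im_term v)))).

Lemma q_termE x : ev q_term x = half_normU2 x.
Proof. by rewrite /= /half_normU2 /chart_coord; ring. Qed.

Lemma g_termE x u v : ev (g_term u v) x = g_chart f x u v.
Proof.
have q := q_termE x; rewrite /g_term /=; rewrite /= in q; rewrite q.
by rewrite /g_chart /Dw_re /Dw_im /chart_coord; ring.
Qed.

Lemma g_term_admissible x u v : chart_dom x -> adm (g_term u v) x.
Proof.
move=> xO; have [y0 _] := xO; have q := q_termE x; have q0 := half_normU2_gt0 x xO.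
rewrite /= in q; rewrite /= q; do ?split=> //.
by rewrite mulf_neq0 // /chart_coord gt_eqF.
Qed.

Lemma pull_g x u v : chart_dom x -> pull_tensor chart (g_f f) u v x = ev (g_term u v) x.
Proof. by move=> xO; rewrite /pull_tensor !derive_chart // g_f_chart // g_termE. Qed.

Lemma pull_omega x u v : chart_dom x ->
  pull_tensor chart (omega_f f) u v x = ev (g_term u (@mul_i R 1 v)) x.
Proof.
move=> xO; rewrite /pull_tensor /omega_f !derive_chart // Istr_chart // g_f_chart //.
by rewrite g_termE.
Qed.

Lemma smooth_on_fval (h : coords -> R) (e : tm) : (forall x, chart_dom x -> adm e x) ->
  (forall x, chart_dom x -> h x = ev e x) -> smooth_on chart_dom h.
Proof.
move=> ae hE; apply: (smooth_on_term_comb chart_coord f chart_coord_is_diff _ _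
  (fun _ : unit => 1 : R) (fun _ => e)) => //.
- exact: chart_dom_open.
- by move=> x _; exact: ae.
move=> x xO; rewrite hE // /term_comb (bigD1 tt) //= big1 => [|[] //].
by rewrite addr0 [RHS]mulr1.
Qed.

(** Derivatives along u, the other vectors being held constant. *)
Definition dDw_re x u v : R := 2 * x 0 i0 * u 0 i0 * v 0 i3
  + 2 * u 0 i0 * (x 0 i3 * v 0 i0 + x 0 i1 * v 0 i2)
  + 2 * x 0 i0 * (u 0 i3 * v 0 i0 + u 0 i1 * v 0 i2).
Definition dDw_im x u v : R := 2 * x 0 i0 * u 0 i0 * v 0 i1
  - 2 * u 0 i0 * (x 0 i3 * v 0 i2 - x 0 i1 * v 0 i0)
  - 2 * x 0 i0 * (u 0 i3 * v 0 i2 - u 0 i1 * v 0 i0).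
Definition dhalf_normU2 x u : R := 2 * (x 0 i3 * u 0 i3 + x 0 i1 * u 0 i1) * x 0 i0 ^+ 4
  + 4 * (x 0 i3 ^+ 2 + x 0 i1 ^+ 2) * x 0 i0 ^+ 3 * u 0 i0.
Definition dg_chart x u v w : R :=
  - hl_derive f (half_normU2 x) * dhalf_normU2 x u
    * ((v 0 i0 * w 0 i0 + v 0 i2 * w 0 i2) / x 0 i0 ^+ 2)
  - 2 * (1 - f (half_normU2 x)) * u 0 i0
    * ((v 0 i0 * w 0 i0 + v 0 i2 * w 0 i2) / x 0 i0 ^+ 3)
  + hl_derive (hl_derive f) (half_normU2 x) * dhalf_normU2 x u
    * (Dw_re x v * Dw_re x w + Dw_im x v * Dw_im x w)
  + hl_derive f (half_normU2 x)
    * (dDw_re x u v * Dw_re x w + Dw_re x v * dDw_re x u w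
       + dDw_im x u v * Dw_im x w + Dw_im x v * dDw_im x u w).

Lemma dg_termE x u v w : x 0 i0 != 0 ->
  ev (dterm chart_coord u (g_term v w)) x = dg_chart x u v w.
Proof.
move=> n0; have q := q_termE x.
have dq : ev (dterm chart_coord u q_term) x = dhalf_normU2 x u.
  by rewrite /= /dhalf_normU2 /chart_coord; ring.
have dre z : ev (dterm chart_coord u (re_term z)) x = dDw_re x u z.
  by rewrite /= /dDw_re /chart_coord; ring.
have dim z : ev (dterm chart_coord u (im_term z)) x = dDw_im x u z.
  by rewrite /= /dDw_im /chart_coord; ring.
have re z : ev (re_term z) x = Dw_re x z by rewrite /= /Dw_re /chart_coord; ring.
have im z : ev (im_term z) x = Dw_im x z by rewrite /= /Dw_im /chart_coord; ring.
rewrite /g_term; move: q dq dre dim re im.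
move: q_term re_term im_term => qt rt it q dq dre dim re im.
rewrite /= q dq !dre !dim !re !im /dg_chart /chart_coord.
by field.
Qed.

Lemma derive_pull_omega x u v w : chart_dom x ->
  'D_u (pull_tensor chart (omega_f f) v w) x = dg_chart x u v (@mul_i R 1 w).
Proof.
move=> xO; have [y0 _] := xO; have n0 : x 0 i0 != 0 by rewrite gt_eqF.
rewrite -dg_termE // -(derive_fval chart_coord f chart_coord_is_diff); last first.
  exact: g_term_admissible.
apply: near_eq_derive.
apply: filterS (open_nbhs_nbhs (conj chart_dom_open xO)) => z zO.
exact: pull_omega.
Qed.

(** In the chart omega_f is (1 - f(t)) da + f'(t) b, where da is the hyperbolic area
    form and b = (i / 2) y^4 Dw /\ conj Dw for Dw = dw - 2 i w dtau / y.  The term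
    f''(t) dt /\ b vanishes because dt is a combination of Dw and conj Dw, and
    db = dt /\ da is the curvature identity of the connection. *)
Lemma omega_closed x u v w : chart_dom x ->
  'D_u (pull_tensor chart (omega_f f) v w) x + 'D_v (pull_tensor chart (omega_f f) w u) x
  + 'D_w (pull_tensor chart (omega_f f) u v) x = 0.
Proof.
move=> xO; have [y0 _] := xO; have n0 : x 0 i0 != 0 by rewrite gt_eqF.
have sum3 (a b c a' b' c' : R) : a = a' -> b = b' -> c = c' ->
  a' + b' + c' = 0 -> a + b + c = 0 by move=> -> -> ->.
apply: (sum3 _ _ _ _ _ _ (derive_pull_omega x u v w xO)
  (derive_pull_omega x v w u xO) (derive_pull_omega x w u v xO)).
rewrite /dg_chart /dhalf_normU2 /dDw_re /dDw_im /Dw_re /Dw_im.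
rewrite !mul_iE.
move: (f (half_normU2 x)) (hl_derive f (half_normU2 x))
  (hl_derive (hl_derive f) (half_normU2 x)) => F0 F1 F2.
move: n0; move: (x 0 i0) (x 0 i1) (x 0 i2) (x 0 i3) => y b xx a n0.
move: (u 0 i0) (u 0 i1) (u 0 i2) (u 0 i3) => u0 u1 u2 u3.
move: (v 0 i0) (v 0 i1) (v 0 i2) (v 0 i3) => v0 v1 v2 v3.
move: (w 0 i0) (w 0 i1) (w 0 i2) (w 0 i3) => w0 w1 w2 w3.
by field.
Qed.

End Kahler.
(** * The pseudo-Kaehler structure *)

Section Assemble.
Context {R : realType}.
Variable f : R -> R.
Hypothesis f_smooth : hl_smooth f.
Hypothesis f_le0 : forall t : R, 0 <= t -> f t <= 0.
Hypothesis f'_lt0 : forall t : R, 0 <= t -> hl_derive f t < 0.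
Notation vect := 'cV[R]_2.
Notation endo := 'M[R]_2.
Notation tens := 'M[R]_(2 * 2).
Notation coords := 'rV[R]_4.
Implicit Types (x u v w : coords).

Lemma pseudo_riemannian_g_f : pseudo_riemannian (1 + 1.+1) (@MR2star R) (g_f f).
Proof.
split.
- move=> p c u v w Mp.
  move=> /(tangentP p _ Mp)[x xO [-> [u' ->]]].
  move=> /(tangent_dchart _ x xO)[v' ->] /(tangent_dchart _ x xO)[w' ->].
  rewrite dchart_linear // ![g_f f _ (dchart _ _) _]g_f_chart //; split.
    exact: g_chartDl.
  by rewrite ![g_chart f x w' _]g_chart_sym g_chartDl.
- apply: locally_param_chart => v w.
  apply: (smooth_on_fval f _ (g_term v w)) => x xO.
    exact: g_term_admissible.
  exact: pull_g.
- move=> p v w Mp /(tangentP p _ Mp)[x xO [-> [v' ->]]].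
  move=> /(tangent_dchart _ x xO)[w' ->].
  by rewrite !g_f_chart // g_chart_sym.
- move=> p v Mp /(tangentP p _ Mp)[x xO [-> [v' ->]]] h.
  rewrite (g_chart_nondegenerate f x v') ?dchart0 // => w.
  by rewrite -g_f_chart // h // tangent_chart //; exists w.
Qed.

Lemma almost_complex_Istr : almost_complex (@MR2star R) (@Istr R).
Proof.
move=> p c v w Mp /(tangentP p _ Mp)[x xO [-> [v' ->]]].
move=> /(tangent_dchart _ x xO)[w' ->].
rewrite dchart_linear // !Istr_chart // tangent_chart //; split.
- by exists (@mul_i R 1 v').
- by rewrite mul_i_linear dchart_linear.
- rewrite mul_iK -[- v']addr0 -scaleN1r -dchart_linear // dchart0 //.
  by rewrite addr0 scaleN1r.
Qed.

Lemma complex_structure_Istr : complex_structure 1 (@MR2star R) (@Istr R).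
Proof.
split; first exact: almost_complex_Istr.
apply: locally_param_chart => u x xO.
by rewrite !derive_chart // Istr_chart.
Qed.

Lemma closed_two_form_omega_f : closed_two_form (1 + 1.+1) (@MR2star R) (omega_f f).
Proof.
split.
- move=> p c u v w Mp.
  move=> /(tangentP p _ Mp)[x xO [-> [u' ->]]].
  move=> /(tangent_dchart _ x xO)[v' ->] /(tangent_dchart _ x xO)[w' ->].
  rewrite dchart_linear // /omega_f !Istr_chart //.
  rewrite ![g_f f _ (dchart _ _) _]g_f_chart //; split.
    exact: g_chartDl.
  by rewrite mul_i_linear ![g_chart f x w' _]g_chart_sym g_chartDl.
- move=> p v Mp /(tangentP p _ Mp)[x xO [-> [v' ->]]].
  rewrite /omega_f Istr_chart // g_f_chart // /g_chart /Dw_re /Dw_im !mul_iE; ring.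
- apply: locally_param_chart; split=> [v w|u v w x xO].
    apply: (smooth_on_fval f _ (g_term v (@mul_i R 1 w))) => x xO.
      exact: g_term_admissible.
    exact: pull_omega.
  exact: omega_closed.
Qed.

Lemma pseudo_kahler_MR2star :
  pseudo_kahler 1 (@MR2star R) (g_f f) (omega_f f) (@Istr R).
Proof.
split; split.
- exact: locally_param_chart.
- exact: pseudo_riemannian_g_f.
- exact: complex_structure_Istr.
- move=> p v w Mp /(tangentP p _ Mp)[x xO [-> [v' ->]]].
  move=> /(tangent_dchart _ x xO)[w' ->].
  have gE := esym (g_f_chart f x v' w' xO).
  apply: etrans (etrans (g_f_chart f x _ _ xO) (etrans (g_chart_mul_i f x v' w') gE)).
  by congr (g_f f _ _ _); exact: Istr_chart.
- by [].
- exact: closed_two_form_omega_f.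
Qed.

End Assemble.

(** * Invariance under SL(2, R) *)

Section Invariance.
Context {R : realType}.
Notation vect := 'cV[R]_2.
Notation endo := 'M[R]_2.
Notation tens := 'M[R]_(2 * 2).
Implicit Types (J A M : endo) (T : tens) (X Y Z W : vect) (p v w : (endo * tens)%type).

Variable A : endo.
Hypothesis detA : \det A = 1.
Let B := invmx A.

Lemma A_unit : A \in unitmx.
Proof. by rewrite unitmxE detA unitr1. Qed.

Let AB : A *m B = 1%:M. Proof. exact: mulmxV A_unit. Qed.
Let BA : B *m A = 1%:M. Proof. exact: mulVmx A_unit. Qed.
Let BAX X : B *m (A *m X) = X. Proof. by rewrite mulmxA BA mul1mx. Qed.
Let ABX X : A *m (B *m X) = X. Proof. by rewrite mulmxA AB mul1mx. Qed.

Lemma rho0_SL2 X Y : rho0 (A *m X) (A *m Y) = rho0 X Y.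
Proof.
rewrite -[RHS]mul1r -detA (expand_det_row _ 0) !sum2 /cofactor !det_mx11 /rho0.
rewrite !mxE !sum2 /=.
have -> : lift 0 0 = 1 :> 'I_2 by exact: val_inj.
have -> : lift 1 0 = 0 :> 'I_2 by exact: val_inj.
by rewrite ?expr0 ?expr1 /=; ring.
Qed.

Lemma gJ_act J X Y : gJ (A *m J *m B) X Y = gJ J (B *m X) (B *m Y).
Proof. by rewrite /gJ -[X in LHS]ABX -!mulmxA rho0_SL2. Qed.

Lemma JR2_act J : JR2 J -> JR2 (A *m J *m B).
Proof.
move=> [J2 [v v0 hv]]; split.
  rewrite -!mulmxA [B *m _]mulmxA BA mul1mx [J *m (J *m _)]mulmxA J2.
  by rewrite mulNmx mul1mx mulmxN AB.
exists (A *m v); last by rewrite -!mulmxA BAX rho0_SL2.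
by apply: contra v0 => /eqP h; rewrite -[v]BAX h mulmx0.
Qed.

Lemma teval_act p X Y Z W :
  teval (act A p).2 X Y Z W = teval p.2 (B *m X) (B *m Y) (B *m Z) (B *m W).
Proof.
rewrite /act /= teval_tensor_of //; have [h1 h2 h3 h4] := teval_multilinear p.2.
by split=> *; rewrite mulmxDr -scalemxAr ?h1 ?h2 ?h3 ?h4.
Qed.

Lemma act_linear : linear (act A).
Proof.
move=> c u v; rewrite [LHS]surjective_pairing [RHS]surjective_pairing; congr (_, _).
  by rewrite /= mulmxDr mulmxDl -scalemxAr -scalemxAl.
apply: tens_ext => i j k l; rewrite teval_act.
have -> : (c *: act A u + act A v).2 = c *: (act A u).2 + (act A v).2 by [].
by rewrite tevalDl !teval_act -tevalDl.
Qed.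

Lemma act_MR2star p : MR2star p -> MR2star (act A p).
Proof.
move=> [[JJ sT aT] T0]; split; first split.
- exact: JR2_act.
- by move=> X Y Z W; rewrite !teval_act; exact: sT.
- by move=> X Y Z W; rewrite !teval_act /= -!mulmxA !BAX aT.
apply: contra T0 => /eqP h; apply/eqP/tens_ext => i j k l.
have := teval_act p (A *m bvec i) (A *m bvec j) (A *m bvec k) (A *m bvec l).
by rewrite !BAX h => <-; rewrite /teval !sum2 !mxE; ring.
Qed.

Lemma Istr_act p v : JR2 p.1 -> Istr (act A p) (act A v) = act A (Istr p v).
Proof.
move=> JJ; rewrite [LHS]surjective_pairing [RHS]surjective_pairing; congr (_, _).
  rewrite /= mulmxN mulNmx; congr (- _).
  by rewrite -!mulmxA [B *m _]mulmxA BA mul1mx.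
apply: tens_ext => i j k l; rewrite teval_act !teval_Istr //; last exact: JR2_act.
by rewrite !teval_act /= -!mulmxA !BAX.
Qed.

Lemma sharp_act J p X Y : JR2 J ->
  sharp (A *m J *m B) (act A p).2 X Y = A *m sharp J p.2 (B *m X) (B *m Y) *m B.
Proof.
move=> JJ; apply: (gJ_inj (A *m J *m B)); first exact: JR2_act.
move=> Z W; rewrite sharpP; last exact: JR2_act.
by rewrite teval_act gJ_act -!mulmxA BAX sharpP.
Qed.

Lemma onb_act J : JR2 J -> orthonormal_for J (fun i => B *m onb (A *m J *m B) i).
Proof. by move=> JJ i j; rewrite -gJ_act onb_orthonormal //; exact: JR2_act. Qed.

Lemma mxtrace_conj M : \tr (A *m M *m B) = \tr M.
Proof. by rewrite mxtrace_mulC mulmxA BA mul1mx. Qed.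

(** The endomorphisms are conjugated by A, which F does not see, and evaluated on
    the A^-1-image of a basis that is orthonormal for A J A^-1; this image is
    orthonormal for J. *)
Lemma sum_sharp_act J (F : endo -> endo -> R) p p' : JR2 J ->
  (forall M M', F (A *m M *m B) (A *m M' *m B) = F M M') ->
  (forall c M M' N, F (c *: M + M') N = c * F M N + F M' N) ->
  (forall c M M' N, F N (c *: M + M') = c * F N M + F N M') ->
  let J' := A *m J *m B in
  \sum_i \sum_j F (sharp J' (act A p).2 (onb J' i) (onb J' j))
                  (sharp J' (act A p').2 (onb J' i) (onb J' j)) =
  \sum_i \sum_j F (sharp J p.2 (onb J i) (onb J j)) (sharp J p'.2 (onb J i) (onb J j)).
Proof.
move=> JJ Fc Fl Fr J'.
rewrite -(contraction2_orthonormal J _ _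
  (fun X Y X' Y' => F (sharp J p.2 X Y) (sharp J p'.2 X' Y'))
  (onb_act J JJ) (onb_orthonormal_for _ JJ)).
  by apply: eq_bigr => i _; apply: eq_bigr => j _; rewrite !(sharp_act J _ _ _ JJ) Fc.
by split=> *; rewrite ?sharp_linearl ?sharp_linearr ?Fl ?Fr.
Qed.

Lemma normU2_act p : JR2 p.1 -> normU2 (act A p) = normU2 p.
Proof.
move=> JJ; rewrite /normU2 /innerV /Uof; congr (_ * _).
apply: (sum_sharp_act p.1 (fun M N => \tr (M *m N)) p p JJ) => // [M M'|c M M' N|c M M' N].
- by rewrite -[RHS]mxtrace_conj -!mulmxA [B *m (A *m _)]mulmxA BA mul1mx.
- by rewrite mulmxDl -scalemxAl mxtraceD mxtraceZ.
- by rewrite mulmxDr -scalemxAr mxtraceD mxtraceZ.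
Qed.

Lemma g_f_act f p v w : JR2 p.1 -> g_f f (act A p) (act A v) (act A w) = g_f f p v w.
Proof.
move=> JJ; rewrite /g_f normU2_act // !innerV_traces; congr (_ * _ + _ * (_ * _)).
  rewrite /innerJ /=; congr (_ * _).
  by rewrite -[RHS]mxtrace_conj -!mulmxA [B *m (A *m _)]mulmxA BA mul1mx.
apply: (sum_sharp_act p.1 (fun M N => \tr (M *m N) - \tr M * \tr N) v w JJ) => //
  [M M'|c M M' N|c M M' N].
- rewrite !mxtrace_conj; congr (_ - _).
  by rewrite -[RHS]mxtrace_conj -!mulmxA [B *m (A *m _)]mulmxA BA mul1mx.
- by rewrite mulmxDl -scalemxAl !mxtraceD !mxtraceZ; ring.
- by rewrite mulmxDr -scalemxAr !mxtraceD !mxtraceZ; ring.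
Qed.

Lemma invariant_under_act f :
  invariant_under (@MR2star R) (act A) (g_f f) (omega_f f) (@Istr R).
Proof.
split; first exact: act_MR2star.
move=> p v w [[JJ _ _] _] _ _; rewrite !(derive_linear _ _ _ _ _ act_linear).
by split; rewrite /omega_f ?Istr_act // g_f_act.
Qed.

End Invariance.

Lemma det_SL2Z (R : realType) (A : 'M[int]_2) : \det A = 1 -> \det (SL2Z_mx A : 'M[R]_2) = 1.
Proof. by move=> h; rewrite /SL2Z_mx det_map_mx h. Qed.

(** * The bundle of quartic differentials *)

Section Quartic.
Context {R : realType}.
Notation vect := 'cV[R]_2.
Notation endo := 'M[R]_2.
Notation tens := 'M[R]_(2 * 2).
Implicit Types (T a b : tens) (X Y Z W : vect) (p v w : (endo * tens)%type).

Lemma sym_swap14 T X Y Z W : totally_symmetric T -> teval T W Y Z X = teval T X Y Z W.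
Proof.
move=> sT.
have s12 X' Y' Z' W' : teval T Y' X' Z' W' = teval T X' Y' Z' W' by case: (sT X' Y' Z' W').
have s23 X' Y' Z' W' : teval T X' Z' Y' W' = teval T X' Y' Z' W' by case: (sT X' Y' Z' W').
have s34 X' Y' Z' W' : teval T X' Y' W' Z' = teval T X' Y' Z' W' by case: (sT X' Y' Z' W').
by rewrite s12 s23 s34 s23 s12.
Qed.

(** Replace Y by J Y in T (J X, J Y, ., .) = - T (X, Y, ., .), and permute. *)
Lemma MR2_shift p X Y Z W : MR2 p ->
  teval p.2 (p.1 *m X) Y Z W = teval p.2 X Y Z (p.1 *m W).
Proof.
move=> [JJ sT aT]; rewrite -(sym_swap14 _ _ _ _ _ sT).
have s12 X' Y' Z' W' : teval p.2 Y' X' Z' W' = teval p.2 X' Y' Z' W' by case: (sT X' Y' Z' W').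
have s23 X' Y' Z' W' : teval p.2 X' Z' Y' W' = teval p.2 X' Y' Z' W' by case: (sT X' Y' Z' W').
have s34 X' Y' Z' W' : teval p.2 X' Y' W' Z' = teval p.2 X' Y' Z' W' by case: (sT X' Y' Z' W').
rewrite -[RHS]s34 -[RHS]s23 -[W in LHS]opprK -(mulJJ _ W JJ).
by rewrite tevalNl -s34 -[in LHS]s23 aT opprK.
Qed.

Lemma teval_to_Q4 p X Y Z W :
  teval (to_Q4 p).2.2 X Y Z W = - teval p.2 X Y Z (p.1 *m W).
Proof.
rewrite /to_Q4 /= teval_opp teval_tensor_of //.
have [h1 h2 h3 h4] := teval_multilinear p.2.
by split=> *; rewrite ?mulmxDr -?scalemxAr.
Qed.

Lemma to_Q4_bij : set_bij (@MR2star R) (@Q4star R) to_Q4.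
Proof.
split.
- move=> p [Mp T0]; have [JJ sT aT] := Mp; split; last first.
    by apply: contra T0 => /eqP [-> _].
  split=> //.
  + move=> X Y Z W; rewrite !teval_to_Q4; have [h1 h2 h3] := sT X Y Z (p.1 *m W).
    split; rewrite ?h1 ?h2 //; congr (- _).
    by rewrite -!MR2_shift //; have [_ _ ->] := sT (p.1 *m X) Y Z W.
  + move=> X Y Z W; rewrite !teval_to_Q4 opprK MR2_shift //; split=> //.
    by rewrite /= MR2_shift // mulJJ // tevalNr opprK.
- move=> [J T] [J' T'] _ _ /= [-> ->] //.
- move=> [J [a b]] [[/= JJ sa sb ab] ab0].
  have bE X Y Z W : teval b X Y Z W = - teval a X Y Z (J *m W).
    rewrite -(sym_swap14 _ _ _ _ _ sa) (ab _ _ _ _).1 opprK.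
    exact: esym (sym_swap14 _ _ _ _ _ sb).
  exists (J, a).
    split; first split=> //= [X Y Z W].
      rewrite (ab _ _ _ _).1; have [<- _ _] := sb X (J *m Y) Z W.
      by rewrite (ab _ _ _ _).2; have [-> _ _] := sa X Y Z W.
    apply: contra ab0 => /= /eqP a0; apply/eqP; congr (_, _) => //.
    by apply: tens_ext => i j k l; rewrite bE a0 !teval0 oppr0.
  rewrite /to_Q4 /=; congr (_, (_, _)).
  apply: tens_ext => i j k l.
  by have := teval_to_Q4 (J, a) (bvec i) (bvec j) (bvec k) (bvec l) => /= ->; rewrite bE.
Qed.

Definition dto_Q4 p v : endo * (tens * tens) :=
  (v.1, (v.2, - tensor_of (fun X Y Z W =>
     teval v.2 X Y Z (p.1 *m W) + teval p.2 X Y Z (v.1 *m W)))).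

Lemma derive_to_Q4 p v : 'D_v to_Q4 p = dto_Q4 p v.
Proof.
apply: (derive_quadratic _ _ to_Q4 p v _
  (0, (0, - tensor_of (fun X Y Z W => teval v.2 X Y Z (v.1 *m W))))) => t.
have -> : to_Q4 (t *: v + p) = (t *: v.1 + p.1, (t *: v.2 + p.2, - tensor_of
    (fun X Y Z W => teval (t *: v.2 + p.2) X Y Z ((t *: v.1 + p.1) *m W)))) by [].
have -> : to_Q4 p + (t *: dto_Q4 p v + t ^+ 2 *:
      (0, (0, - tensor_of (fun X Y Z W => teval v.2 X Y Z (v.1 *m W))))) =
    (p.1 + (t *: v.1 + t ^+ 2 *: 0), (p.2 + (t *: v.2 + t ^+ 2 *: 0),
     (to_Q4 p).2.2 + (t *: (dto_Q4 p v).2.2 + t ^+ 2 *: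
       - tensor_of (fun X Y Z W => teval v.2 X Y Z (v.1 *m W))))) by [].
congr (_, (_, _)); rewrite ?scaler0 ?addr0 1?addrC //.
apply: tens_ext => i j k l; rewrite !teval_bvec !(tensor_ofE, mxE).
have [_ _ _ h] := teval_multilinear p.2; have [_ _ _ k4] := teval_multilinear v.2.
by rewrite mulmxDl -scalemxAl [p.2 + _]addrC tevalDl h k4; ring.
Qed.

Lemma teval_dto_Q4 p v X Y Z W : teval (dto_Q4 p v).2.2 X Y Z W =
  - (teval v.2 X Y Z (p.1 *m W) + teval p.2 X Y Z (v.1 *m W)).
Proof.
rewrite /dto_Q4 /= teval_opp teval_tensor_of //.
have [h1 h2 h3 h4] := teval_multilinear p.2.
have [k1 k2 k3 k4] := teval_multilinear v.2.
split=> *; rewrite ?mulmxDr -?scalemxAr.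
- by rewrite h1 k1; ring.
- by rewrite h2 k2; ring.
- by rewrite h3 k3; ring.
- by rewrite h4 k4; ring.
Qed.

(** For tangent v = (J', T') the tensor of I v is symmetric; exchanging its last two
    arguments moves J and J' to the last slot, which turns it into the imaginary part
    of q'.  The same computation for I (I v) = - v gives the other component. *)
Lemma Istr_comes_from_Q4 : comes_from_Q4 (@Istr R).
Proof.
split; first exact: to_Q4_bij.
move=> p v Mp tv; rewrite !derive_to_Q4.
have JJ : JR2 p.1 by case: Mp => [[]].
have [sT sv sS II] : [/\ totally_symmetric p.2, totally_symmetric v.2,
    totally_symmetric (Istr p v).2 & Istr p (Istr p v) = - v].
  have [_ _ h] := almost_complex_Istr p 1 v v Mp tv tv.
  have [x xO [e1 [u e2]]] := tangentP p v Mp tv.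
  split=> //; first by case: Mp => [[]].
    by rewrite e2; exact: symt_sym.
  by rewrite e1 e2 Istr_chart //; exact: symt_sym.
have E2 : (Istr p v).2 = (dto_Q4 p v).2.2.
  apply: tens_ext => i j k l; rewrite teval_dto_Q4.
  have [_ _ <-] := sS (bvec i) (bvec j) (bvec k) (bvec l); rewrite teval_Istr //.
  have [_ _ ->] := sv (bvec i) (bvec j) (bvec k) (p.1 *m bvec l).
  have [_ _ ->] := sT (bvec i) (bvec j) (bvec k) (v.1 *m bvec l).
  by rewrite opprD.
have E3 : (dto_Q4 p (Istr p v)).2.2 = - v.2.
  apply: tens_ext => i j k l; rewrite teval_dto_Q4.
  have -> : - v.2 = (Istr p (Istr p v)).2 by rewrite II.
  have sII : totally_symmetric (Istr p (Istr p v)).2.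
    by rewrite II => X Y Z W; rewrite !teval_opp; have [-> -> ->] := sv X Y Z W.
  have [_ _ <-] := sII (bvec i) (bvec j) (bvec k) (bvec l).
  rewrite (teval_Istr p (Istr p v)) //.
  have [_ _ ->] := sS (bvec i) (bvec j) (bvec k) (p.1 *m bvec l).
  have [_ _ ->] := sT (bvec i) (bvec j) (bvec k) ((Istr p v).1 *m bvec l).
  by rewrite opprD.
by rewrite /I_Q4 -E2 -E3.
Qed.

End Quartic.

Theorem theoremB (R : realType) (f : R -> R)
    (f_smooth : hl_smooth f)
    (f_le0 : forall t : R, 0 <= t -> f t <= 0)
    (f'_lt0 : forall t : R, 0 <= t -> hl_derive f t < 0)
    (f0 : f 0 = 0) :
  [/\ pseudo_kahler 1 (@MR2star R) (g_f f) (omega_f f) (@Istr R),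
      (forall A : 'M[int]_2, \det A = 1 ->
         invariant_under (@MR2star R) (act (SL2Z_mx A)) (g_f f) (omega_f f) (@Istr R))
    & comes_from_Q4 (@Istr R)].
Proof.
split; first exact: pseudo_kahler_MR2star.
  by move=> A detA; apply: invariant_under_act; exact: det_SL2Z.
exact: Istr_comes_from_Q4.
Qed.
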